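(* The embedding of the gamma function by $\Gamma(s)=(2\pi)^{\frac{1-\tau}{2}}\tau^{s-\frac12}\frac{G(s+\tau;\tau)}{G(s;\tau)}$ sends every Meijer $G$-function (hence every ${}_pF_q$) to a $K$-function with $N=0$. Starting from any finite collection of such functions and applying any composition of the transform operations (Euler, Erdélyi–Kober and Riemann–Liouville integrals, differentiation, Laplace transform, Mellin convolution) together with the shift, inversion and modular laws, all described in the context, one never leaves the stratum $N=0$: the single-kernel operations preserve $N$, and Mellin convolution adds it ($N=N_1+N_2$), so $0+0=0$ closes the stratum under that operation too. In particular: (a) all five applications of $K$-functions given by Karp and Kuznetsov have $N=0$, as one sees by direct inspection: they are of the types $K^{1,1}_{2,2}$, $K^{1,1}_{2,2}$, $K^{1,2}_{3,3}$, $K^{p+1,1}_{p+2,p+2}$, $K^{2,0}_{2,2}$; (b) a $K$-function with $N\ne0$, and in particular one with $N<0$, cannot be produced from hypergeometric input by the classical transform calculus (the operations above). It must be assembled from double-gamma data directly, for instance from a Mellin transform satisfying $M(s+1)=R(s)M(s)$ with $R$ a ratio of gammas whose numerator and denominator have different lengths.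
   Context: Let $\tau>0$ and let $G(z;\tau)$ be the Barnes double gamma function: the entire function $G(z;\tau)=\frac{z}{\tau}e^{c_1 z/\tau+c_2 z^2/(2\tau^2)}\prod_{(k,l)\in\mathbb{Z}_{\ge0}^2\setminus\{(0,0)\}}\big(1+\frac{z}{k\tau+l}\big)e^{-\frac{z}{k\tau+l}+\frac{z^2}{2(k\tau+l)^2}}$, with real constants $c_1,c_2$ uniquely determined by $G(z+1;\tau)=\Gamma(z/\tau)G(z;\tau)$ and $G(z+\tau;\tau)=(2\pi)^{(\tau-1)/2}\tau^{1/2-z}\Gamma(z)G(z;\tau)$. For integers $0\le m\le q$, $0\le n\le p$ and $\mathbf a\in\mathbb{C}^p$, $\mathbf b\in\mathbb{C}^q$, $\alpha\in\mathbb{C}$, the $K$-function of type $K^{m,n}_{p,q}$ is a contour integral $\frac{1}{2\pi i}\int_\gamma\phi(s)z^{-s}ds$ with kernel $\phi(s)=\mathcal G(s)e^{\pi\alpha s^2/\tau}$, $$\mathcal G(s)=\frac{\prod_{j=1}^{m}G(b_j-s;\tau)\prod_{j=1}^{n}G(1+\tau-a_j+s;\tau)}{\prod_{j=m+1}^{q}G(1+\tau-b_j+s;\tau)\prod_{j=n+1}^{p}G(a_j-s;\tau)},$$ and its stratum is the integer $N=2(m+n)-p-q$. The four products are called blocks (numerator $b$, numerator $a$, denominator $b$, denominator $a$). The Meijer $G$-function is $\frac{1}{2\pi i}\int_L\frac{\prod_{j\le m}\Gamma(b_j-s)\prod_{j\le n}\Gamma(1-a_j+s)}{\prod_{m<j\le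 q}\Gamma(1-b_j+s)\prod_{n<j\le p}\Gamma(a_j-s)}z^s\,ds$; the embedding replaces each gamma factor by the corresponding ratio of $G$'s, the remaining elementary factors giving a constant and a rescaling of the argument. Hypergeometric input means functions obtained in this way. Operations. Single-kernel operations multiply the kernel by a ratio of ordinary gamma functions: Erdélyi–Kober $I^{\gamma,\delta}_1f(z)=\frac1{\Gamma(\delta)}\int_0^1(1-\sigma)^{\delta-1}\sigma^\gamma f(z\sigma)d\sigma$, multiplier $\frac{\Gamma(\gamma+1-s)}{\Gamma(\gamma+\delta+1-s)}$ (hence the Riemann–Liouville integral $z^\delta I^{0,\delta}_1$); Euler transform $\int_0^1t^{\beta-1}(1-t)^{\gamma-1}f(zt)dt$, multiplier $\Gamma(\gamma)\frac{\Gamma(\beta-s)}{\Gamma(\beta+\gamma-s)}$; differentiation $d^k/dz^k$, multiplier $(-1)^k\frac{\Gamma(s+k)}{\Gamma(s)}$ together with the factor $z^{-k}$; Laplace transform, multiplier $\Gamma(s)$ together with the reflection $s\mapsto1-s$. Each gamma factor is absorbed into the kernel, up to a factor $C\lambda^{-s}$ (a constant and a rescaling of $z$) and with the same $\tau,\alpha$, by four rules: $\Gamma(c-s)$ adds the $a$-parameter $c$ to the denominator block and the $b$-parameter $c+\tau$ to the numerator block; $\Gamma(c+s)$ adds the $a$-parameter $1-c$ (numerator) and the $b$-parameter $1+\tau-c$ (denominator); $1/\Gamma(c-s)$ adds the $a$-parameter $c+\tau$ (denominator) and the $b$-parameter $c$ (numerator); $1/\Gamma(c+s)$ adds the $a$-parameter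 $1+\tau-c$ (numerator) and the $b$-parameter $1-c$ (denominator). A numerator $a$ increments $n,p$; a denominator $a$ increments $p$; a numerator $b$ increments $m,q$; a denominator $b$ increments $q$. Mellin convolution $\int_0^\infty K_1(x/t)K_2(t)\frac{dt}{t}$ of two $K$-functions with common $\tau$ multiplies their kernels (blocks concatenated, $\alpha=\alpha_1+\alpha_2$). The Laplace transform and Mellin convolution are taken at the level of kernels (formal identities). Shift law: $K(c+\mathbf a;c+\mathbf b\,|\,z;\tau,\alpha)=e^{\pi\alpha c^2/\tau}z^{-c}K(\mathbf a;\mathbf b\,|\,e^{-2\pi\alpha c/\tau}z;\tau,\alpha)$. Inversion law: $K^{m,n}_{p,q}(\mathbf a;\mathbf b\,|\,z)=K^{n,m}_{q,p}(1+\tau-\mathbf b;1+\tau-\mathbf a\,|\,z^{-1})$, the contour being reflected by $s\mapsto-s$. Modular law: $K(\mathbf a;\mathbf b\,|\,z;\tau,\alpha)=A\tau\,K(\tau^{-1}\mathbf a;\tau^{-1}\mathbf b\,|\,(Bz)^\tau;\tau^{-1},\alpha-\frac{N}{2\pi}\ln\tau)$, where $A,B$ are the constants (independent of $s$) in $\mathcal G(s)=A\,B^{-s}\tau^{-Ns^2/(2\tau)}\mathcal G^{(\tau^{-1})}(s\tau^{-1})$, $\mathcal G^{(\tau^{-1})}$ being $\mathcal G$ with $(\mathbf a,\mathbf b,\tau)$ replaced by $(\tau^{-1}\mathbf a,\tau^{-1}\mathbf b,\tau^{-1})$. *)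

(* Defs.v *)
From Stdlib Require Import Reals ZArith List.
From Coquelicot Require Import Coquelicot.
Import ListNotations.

Open Scope R_scope.
Open Scope C_scope.

(** ** Complex preliminaries *)

Definition Cexp (z : C) : C :=
  (exp (Re z) * cos (Im z), exp (Re z) * sin (Im z))%R.

Definition Clim (u : nat -> C) : C :=
  (real (Lim_seq (fun n => Re (u n))), real (Lim_seq (fun n => Im (u n)))).

Definition Cprod (l : list C) : C := fold_right Cmult 1 l.

Definition nonpos_int (z : C) : Prop := exists k : nat, z = - INR k.

(** Gauss's limit [n! n^s / (s (s+1) ... (s+n))].  At the poles every term with
    large [n] is [x / 0 = 0], so there [Gamma s = 0] and [/ Gamma s = 0]; the
    second value is the right one for the entire function [1/Gamma]. *)
Definition Gamma (s : C) : C :=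
  Clim (fun n => INR (fact n) * Cexp (s * ln (INR n))
                 / Cprod (map (fun j => s + INR j) (seq 0 (S n)))).

(** Equality of meromorphic functions: Rocq functions carry junk values at
    poles and at removable singularities, which form a locally finite set. *)
Definition locally_finite (E : C -> Prop) : Prop :=
  forall r : R, exists l : list C,
  forall s : C, E s -> (Cmod s <= r)%R -> In s l.

Definition mero_eq (f g : C -> C) : Prop :=
  exists E : C -> Prop, locally_finite E /\ forall s, ~ E s -> f s = g s.

(** ** The Barnes double gamma function *)

Definition dg_factor (tau : R) (z : C) (kl : nat * nat) : C :=
  let w : C := RtoC (INR (fst kl) * tau + INR (snd kl))%R in
  (1 + z / w) * Cexp (- (z / w) + z ^ 2 / (2 * w ^ 2)).

Definition dg_index (n : nat) : list (nat * nat) :=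
  filter (fun kl => negb (Nat.eqb (fst kl + snd kl) 0))
    (list_prod (seq 0 (S n)) (seq 0 (S n))).

(** The product converges absolutely, so its value is the limit of the partial
    products over the squares [0 <= k, l <= n]. *)
Definition dg_partial (tau : R) (n : nat) (z : C) : C :=
  Cprod (map (dg_factor tau z) (dg_index n)).

(** [g] is [G(. ; tau)].  The functional equations determine the real constants
    [c1], [c2]; they are stated off the poles of their gamma factor. *)
Definition is_double_gamma (tau : R) (g : C -> C) : Prop :=
  exists c1 c2 : R,
    (forall z : C,
      filterlim
        (fun n => z / tau
                  * Cexp (c1 * z / tau + c2 * z ^ 2 / (2 * tau ^ 2))
                  * dg_partial tau n z)
        eventually (locally (g z)))
    /\ (forall z : C, ~ nonpos_int (z / tau) ->
          g (z + 1) = Gamma (z / tau) * g z)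
    /\ (forall z : C, ~ nonpos_int z ->
          g (z + tau) =
          RtoC (Rpower (2 * PI) ((tau - 1) / 2))
          * Cexp ((1 / 2 - z) * ln tau) * Gamma z * g z).

(** ** K-functions *)

(** The vectors [a], [b] are stored as their numerator and denominator blocks:
    [a = anum ++ aden], [b = bnum ++ bden]. *)
Record Kdata := mkK {
  ktau : R;
  kalpha : C;
  bnum : list C;
  anum : list C;
  bden : list C;
  aden : list C }.

Definition km (D : Kdata) : nat := length (bnum D).
Definition kn (D : Kdata) : nat := length (anum D).
Definition kp (D : Kdata) : nat := length (anum D ++ aden D).
Definition kq (D : Kdata) : nat := length (bnum D ++ bden D).

Definition has_type (D : Kdata) (m n p q : nat) : Prop :=
  km D = m /\ kn D = n /\ kp D = p /\ kq D = q.

Definition stratum (D : Kdata) : Z :=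
  (2 * (Z.of_nat (km D) + Z.of_nat (kn D)) - Z.of_nat (kp D) - Z.of_nat (kq D))%Z.

Definition num_args (D : Kdata) (s : C) : list C :=
  map (fun b => b - s) (bnum D) ++ map (fun a => 1 + ktau D - a + s) (anum D).

Definition den_args (D : Kdata) (s : C) : list C :=
  map (fun b => 1 + ktau D - b + s) (bden D) ++ map (fun a => a - s) (aden D).

(** In [kkernel] and below, [G tau] plays the role of [G(. ; tau)]. *)
Definition kkernel (G : R -> C -> C) (D : Kdata) (s : C) : C :=
  Cprod (map (G (ktau D)) (num_args D s))
  / Cprod (map (G (ktau D)) (den_args D s))
  * Cexp (PI * kalpha D * s ^ 2 / ktau D).

Definition kregular (G : R -> C -> C) (D : Kdata) (s : C) : Prop :=
  List.Forall (fun x => G (ktau D) x <> 0) (num_args D s ++ den_args D s).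

(** [phi] is the kernel of [D] up to [C lambda^(-s)], with [C = e^u] and
    [lambda = e^v]: its function is [C K(lambda z)].  The exponent [v] fixes a
    branch of [lambda^(-s)]; [lambda] need not be positive (cf. the shift law). *)
Definition represents (G : R -> C -> C) (D : Kdata) (phi : C -> C) : Prop :=
  exists u v : C, mero_eq phi (fun s => Cexp (u - v * s) * kkernel G D s).

(** ** Contour integrals *)

Record contour := mkContour { path : R -> C; speed : R -> C }.

Definition is_contour (g : contour) : Prop :=
  forall t : R, @is_derive R_AbsRing C_R_NormedModule (path g) t (speed g t).

(** The image under [s |-> -s], traversed so that an upward contour stays
    upward. *)
Definition creflect (g : contour) : contour :=
  mkContour (fun t => - path g (- t)%R) (fun t => speed g (- t)%R).

(** [is_contour_int f g w]: [w] is [1 / (2 pi i)] times the integral of [f]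
    along [g]. *)
Definition is_contour_int (f : C -> C) (g : contour) (w : C) : Prop :=
  @is_RInt_gen C_R_NormedModule (fun t => f (path g t) * speed g t)
    (Rbar_locally m_infty) (Rbar_locally p_infty) (2 * PI * Ci * w).

(** The variable [z] lives on the Riemann surface of the logarithm:
    [zeta = log z] and [z^s = exp (s zeta)]. *)
Definition is_K_value (G : R -> C -> C) (D : Kdata) (g : contour) (zeta w : C)
  : Prop :=
  is_contour_int (fun s => kkernel G D s * Cexp (- s * zeta)) g w.

(** ** Meijer G-functions *)

Record Mdata := mkM {
  mbnum : list C;
  manum : list C;
  mbden : list C;
  maden : list C }.

Definition mkernel (M : Mdata) (s : C) : C :=
  Cprod (map (fun b => Gamma (b - s)) (mbnum M))
  * Cprod (map (fun a => Gamma (1 - a + s)) (manum M))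
  / (Cprod (map (fun b => Gamma (1 - b + s)) (mbden M))
     * Cprod (map (fun a => Gamma (a - s)) (maden M))).

(** The Meijer integrand carries [z^s], not [z^(-s)]. *)
Definition is_M_value (M : Mdata) (g : contour) (zeta w : C) : Prop :=
  is_contour_int (fun s => mkernel M s * Cexp (s * zeta)) g w.

Definition pochhammer (x : C) (k : nat) : C :=
  Cprod (map (fun j => x + INR j) (seq 0 k)).

Definition pFq_coef (a b : list C) (k : nat) : C :=
  Cprod (map (fun x => pochhammer x k) a)
  / (Cprod (map (fun x => pochhammer x k) b) * INR (fact k)).

(** The Mellin-Barnes kernel of [pFq(a1 ++ a2; b; .)].  For the upper parameters
    in [a2] (nonpositive integers in its use) the factor [Gamma (x + s)], which
    would be singular at [s = 0], is replaced by [1 / Gamma (1 - x - s)]; both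
    are proportional, up to a sign [(-1)^k], to [(x)_k] at [s = k]. *)
Definition pFq_meijer (a1 a2 b : list C) : Mdata :=
  mkM [RtoC 0] (map (fun x => 1 - x) a1)
      (map (fun x => 1 - x) b) (map (fun x => 1 - x) a2).

(** ** The embedding, and the transform operations on kernels and parameters *)

Definition kembed (tau : R) (M : Mdata) : Kdata :=
  mkK tau 0
    (map (fun b => b + tau) (mbnum M) ++ maden M)
    (manum M ++ map (fun b => b + tau) (mbden M))
    (map (fun a => a + tau) (manum M) ++ mbden M)
    (mbnum M ++ map (fun a => a + tau) (maden M)).

(** Absorption of [Gamma (c - s)], [Gamma (c + s)], [1 / Gamma (c - s)] and
    [1 / Gamma (c + s)]. *)
Definition absorb_gm (c : C) (D : Kdata) : Kdata :=
  mkK (ktau D) (kalpha D)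
    (bnum D ++ [c + ktau D]) (anum D) (bden D) (aden D ++ [c]).

Definition absorb_gp (c : C) (D : Kdata) : Kdata :=
  mkK (ktau D) (kalpha D)
    (bnum D) (anum D ++ [1 - c]) (bden D ++ [1 + ktau D - c]) (aden D).

Definition absorb_rgm (c : C) (D : Kdata) : Kdata :=
  mkK (ktau D) (kalpha D)
    (bnum D ++ [c]) (anum D) (bden D) (aden D ++ [c + ktau D]).

Definition absorb_rgp (c : C) (D : Kdata) : Kdata :=
  mkK (ktau D) (kalpha D)
    (bnum D) (anum D ++ [1 + ktau D - c]) (bden D ++ [1 - c]) (aden D).

Definition kshift (c : C) (D : Kdata) : Kdata :=
  mkK (ktau D) (kalpha D)
    (map (Cplus c) (bnum D)) (map (Cplus c) (anum D))
    (map (Cplus c) (bden D)) (map (Cplus c) (aden D)).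

Definition kinvert (D : Kdata) : Kdata :=
  let r := map (fun x => 1 + ktau D - x) in
  mkK (ktau D) (kalpha D)
    (r (anum D)) (r (bnum D)) (r (aden D)) (r (bden D)).

Definition kmodular (D : Kdata) : Kdata :=
  let r := map (fun x => x / ktau D) in
  mkK (/ ktau D)
    (kalpha D - RtoC (IZR (stratum D) / (2 * PI) * ln (ktau D))%R)
    (r (bnum D)) (r (anum D)) (r (bden D)) (r (aden D)).

Definition kconvolve (D1 D2 : Kdata) : Kdata :=
  mkK (ktau D1) (kalpha D1 + kalpha D2)
    (bnum D1 ++ bnum D2) (anum D1 ++ anum D2)
    (bden D1 ++ bden D2) (aden D1 ++ aden D2).

Inductive operation :=
| ErdelyiKober (gamma delta : C)
| RiemannLiouville (delta : C)
| Euler (beta gamma : C)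
| Differentiation (k : nat)
| Laplace
| Shift (c : C)
| Inversion
| Modular.

(** Convergence of the integrals over [(0, 1)] at the end point [1]. *)
Definition op_ok (o : operation) : Prop :=
  match o with
  | ErdelyiKober _ delta => (0 < Re delta)%R
  | RiemannLiouville delta => (0 < Re delta)%R
  | Euler _ gamma => (0 < Re gamma)%R
  | _ => True
  end.

Definition op_tau (o : operation) (tau : R) : R :=
  match o with Modular => (/ tau)%R | _ => tau end.

(** Effect on the kernel of [f(z) = 1/(2 pi i) int phi(s) z^(-s) ds].  A factor
    [z^(-c)] amounts to [phi(s - c)]; [Shift c] is multiplication by [z^(-c)];
    [Inversion] is [f(1/z)]; [Modular] takes [z^tau] as the new variable, i.e.
    it is [f(z^(1/tau))]. *)
Definition op_kernel (o : operation) (tau : R) (phi : C -> C) : C -> C :=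
  match o with
  | ErdelyiKober gamma delta => fun s =>
      Gamma (gamma + 1 - s) / Gamma (gamma + delta + 1 - s) * phi s
  | RiemannLiouville delta => fun s =>
      let s' := s + delta in Gamma (1 - s') / Gamma (delta + 1 - s') * phi s'
  | Euler beta gamma => fun s =>
      Gamma gamma * (Gamma (beta - s) / Gamma (beta + gamma - s)) * phi s
  | Differentiation k => fun s =>
      let s' := s - INR k in
      (- (1)) ^ k * (Gamma (s' + INR k) / Gamma s') * phi s'
  | Laplace => fun s => Gamma s * phi (1 - s)
  | Shift c => fun s => phi (s - c)
  | Inversion => fun s => phi (- s)
  | Modular => fun s => tau * phi (tau * s)
  end.

Definition op_data (o : operation) (D : Kdata) : Kdata :=
  match o with
  | ErdelyiKober gamma delta =>
      absorb_rgm (gamma + delta + 1) (absorb_gm (gamma + 1) D)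
  | RiemannLiouville delta =>
      kshift (- delta) (absorb_rgm (delta + 1) (absorb_gm 1 D))
  | Euler beta gamma => absorb_rgm (beta + gamma) (absorb_gm beta D)
  | Differentiation k =>
      kshift (INR k) (absorb_rgp 0 (absorb_gp (INR k) D))
  | Laplace => absorb_gp 0 (kshift 1 (kinvert D))
  | Shift c => kshift c D
  | Inversion => kinvert D
  | Modular => kmodular D
  end.

(** [produced tau phi]: [phi] is a kernel, in the calculus with parameter [tau],
    obtained from hypergeometric input by finitely many operations.  Written with
    [z^(-s)], the Meijer G-function of [M] has kernel [mkernel M (- s)]. *)
Inductive produced : R -> (C -> C) -> Prop :=
| produced_input (tau : R) (M : Mdata) :
    (0 < tau)%R -> produced tau (fun s => mkernel M (- s))
| produced_op (tau : R) (o : operation) (phi : C -> C) :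
    op_ok o -> produced tau phi -> produced (op_tau o tau) (op_kernel o tau phi)
| produced_convolution (tau : R) (phi psi : C -> C) :
    produced tau phi -> produced tau psi ->
    produced tau (fun s => phi s * psi s)
| produced_scale (tau : R) (u v : C) (phi : C -> C) :
    produced tau phi -> produced tau (fun s => Cexp (u - v * s) * phi s)
| produced_eq (tau : R) (phi psi : C -> C) :
    mero_eq phi psi -> produced tau phi -> produced tau psi.

(** The kernel [prod_c G(c + s; tau) / prod_d G(d + s; tau)], which solves
    [M(s + 1) = R(s) M(s)] for the ratio [R] below. *)
Definition ratio_data (tau : R) (cs ds : list C) : Kdata :=
  mkK tau 0 [] (map (fun c => 1 + tau - c) cs) (map (fun d => 1 + tau - d) ds) [].

Definition gamma_ratio (tau : R) (cs ds : list C) (s : C) : C :=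
  Cprod (map (fun c => Gamma ((c + s) / tau)) cs)
  / Cprod (map (fun d => Gamma ((d + s) / tau)) ds).

(* Main.v *)
Require Import Defs.
From Stdlib Require Import Reals ZArith List.
From Coquelicot Require Import Coquelicot.
From Stdlib Require Import Lra Lia.
From Stdlib Require FinFun.
Import ListNotations.
Open Scope R_scope.
Open Scope C_scope.

(** Four facts carry the proof.

    1. The double gamma function [G(. ; tau)] vanishes exactly at the points
    [-(k tau + l)] with [k, l >= 0], a locally finite set ([double_gamma_zeros]).
    Grouping the factors of the product by the shells [max(k, l) = n + 1], the
    [n]-th shell is [1 + O(n^-2)], because [(1 + z) exp(-z + z^2/2) = 1 + O(z^3)]
    and the shell has [2 n + 3] factors.  Hence both functional equations may be
    divided by [G], and [Gamma z] is [G(z + tau; tau) / G(z; tau)] times an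
    exponential of an affine function ([Gamma_embed]).  Every identity of kernels
    needed for the embedding, the absorption rules, the shift and inversion laws
    and Mellin convolution follows by comparing arguments; the bookkeeping of
    block lengths gives the statements about [N].

    2. The products defining [G(z; tau)] and [G(z / tau; 1 / tau)] have the same
    partial products up to the exchange of [k] and [l], so the two functions differ
    by the exponential of a quadratic polynomial.  The functional equations on the
    positive axis force its leading coefficient to be [- ln tau / (2 tau)]
    ([G_modular]).  With one such factor for each argument, the coefficients of
    [s^2] add up to a multiple of [N], which is the shift of [alpha] in the modular
    law ([kkernel_modular]).

    3. The reciprocal gamma function, as the locally uniform limit of the
    reciprocals of Gauss's quotients, is continuous, vanishes exactly at the
    nonpositive integers, and satisfies [rGamma s = s rGamma (s + 1)].  This gives
    the residues of the hypergeometric kernel ([pFq_residues]).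

    4. A function determines the ratio [N / tau] of any data representing it
    ([stratum_ratio]); this is why a kernel with [N <> 0] is never produced from
    hypergeometric input.  The third multiplicative difference of a kernel with
    steps [1], [tau], [h] cancels the elementary factors, which are exponentials of
    quadratic polynomials.  By the two functional equations
    [G(z + 1) = Gamma(z / tau) G(z)] and [Gamma(z + 1) = z Gamma(z)], it is a
    product of factors [1 + h / (s + d)] over the numerator blocks divided by one
    over the denominator blocks, hence [1 + N h / s + o(1 / s)] at infinity.  For
    data with parameters [tau1] and [tau2], taking the steps [1], [tau1], [tau2]
    gives [N1 tau2 = N2 tau1]. *)

Set Bullet Behavior "Strict Subproofs".

(** * Complex arithmetic and limits *)

Lemma C_eq (x y : C) : Re x = Re y -> Im x = Im y -> x = y.
Proof. destruct x, y; simpl; intros; subst; reflexivity. Qed.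

Lemma Cinv_0 : / RtoC 0 = 0.
Proof. apply C_eq; simpl; unfold Rdiv; ring. Qed.

(** Since [/ 0 = 0], inversion is multiplicative without side conditions.  The
    identities that only rearrange the products in a kernel therefore hold at every
    point, poles included. *)
Lemma Cinv_mult_total (a b : C) : / (a * b) = / a * / b.
Proof.
destruct (Ceq_dec a 0) as [->|Ha].
  now rewrite Cmult_0_l, Cinv_0, Cmult_0_l.
destruct (Ceq_dec b 0) as [->|Hb].
  now rewrite Cmult_0_r, Cinv_0, Cmult_0_r.
now field.
Qed.

Lemma Cinv_inv_total (a : C) : / / a = a.
Proof.
destruct (Ceq_dec a 0) as [->|Ha].
  now rewrite !Cinv_0.
field; auto.
Qed.

Lemma Cinv_neq_0 (a : C) : a <> 0 -> / a <> 0.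
Proof.
intros Ha H. apply Ha. now rewrite <- (Cinv_inv_total a), H, Cinv_0.
Qed.

Lemma Cdiv_neq_0 (a b : C) : a <> 0 -> b <> 0 -> a / b <> 0.
Proof. intros; apply Cmult_neq_0; auto using Cinv_neq_0. Qed.

Lemma Cexp_plus (x y : C) : Cexp (x + y) = Cexp x * Cexp y.
Proof.
destruct x as [a b], y as [c d]; apply C_eq; unfold Cexp, Re, Im; simpl;
  rewrite ?exp_plus, ?cos_plus, ?sin_plus; ring.
Qed.

Lemma Cexp_0 : Cexp 0 = 1.
Proof. apply C_eq; unfold Cexp; simpl; rewrite exp_0, ?cos_0, ?sin_0; ring. Qed.

Lemma Cexp_opp (x : C) : Cexp (- x) = / Cexp x.
Proof.
assert (H : Cexp (-x) * Cexp x = 1).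
  rewrite <- Cexp_plus. replace (-x + x) with (RtoC 0) by ring. apply Cexp_0.
assert (Cexp x <> 0).
  intros E; rewrite E, Cmult_0_r in H. symmetry in H. now apply C1_nz.
rewrite <- (Cmult_1_l (/ Cexp x)), <- H. now field.
Qed.

Lemma Cexp_neq_0 (x : C) : Cexp x <> 0.
Proof.
intros E. apply C1_nz.
rewrite <- Cexp_0. replace (RtoC 0) with (x + - x) at 1 by ring.
rewrite Cexp_plus, E. ring.
Qed.

Lemma Cexp_RtoC (x : R) : Cexp (RtoC x) = RtoC (exp x).
Proof. apply C_eq; unfold Cexp; simpl; rewrite ?cos_0, ?sin_0; ring. Qed.

Lemma Cmod_Cexp (x : C) : Cmod (Cexp x) = exp (Re x).
Proof.
unfold Cmod, Cexp; simpl.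
replace (_ + _)%R with (exp (Re x) * exp (Re x) * (Rsqr (sin (Im x)) + Rsqr (cos (Im x))))%R
  by (unfold Rsqr; ring).
rewrite sin2_cos2, Rmult_1_r. apply sqrt_square. left; apply exp_pos.
Qed.

Lemma Cexp_surj (z : C) : z <> 0 -> exists u : C, Cexp u = z.
Proof.
intros Hz. assert (Hm : (0 < Cmod z)%R) by now apply Cmod_gt_0.
set (x := (Re z / Cmod z)%R). set (y := (Im z / Cmod z)%R).
assert (Hxy : (x * x + y * y = 1)%R).
{ generalize (Cmod2_alt z). intros H. unfold x, y.
  replace (_ + _)%R with ((Re z ^ 2 + Im z ^ 2) / (Cmod z ^ 2))%R by (field; lra).
  rewrite <- H. field. lra. }
assert (Hx : (-1 <= x <= 1)%R) by nra.
(* The angle [t] is [acos x] or its opposite, according to the sign of [y]. *)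
assert (E : exists t, cos t = x /\ sin t = y).
{ destruct (Rle_dec 0 y) as [Hy|Hy].
  - exists (acos x). split. now apply cos_acos.
    rewrite sin_acos; auto. rewrite <- (sqrt_square y) by auto. f_equal. unfold Rsqr; lra.
  - exists (- acos x)%R. rewrite cos_neg, sin_neg. split. now apply cos_acos.
    rewrite sin_acos; auto. replace (1 - x²)%R with ((-y)*(-y))%R by (unfold Rsqr; lra).
    rewrite sqrt_square; lra. }
destruct E as (t & Ht1 & Ht2).
exists (ln (Cmod z), t). unfold Cexp; cbn [Re Im fst snd]. rewrite exp_ln; auto.
rewrite Ht1, Ht2. apply C_eq; unfold x, y; simpl; field; lra.
Qed.

Lemma Cprod_app l1 l2 : Cprod (l1 ++ l2) = Cprod l1 * Cprod l2.
Proof.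
induction l1 as [|a l IH]; simpl. now rewrite Cmult_1_l. rewrite IH; ring.
Qed.

Lemma Cprod_cons a l : Cprod (a :: l) = a * Cprod l.
Proof. reflexivity. Qed.

Lemma Cprod_nil : Cprod [] = 1.
Proof. reflexivity. Qed.

Lemma Cprod_neq_0 {A} (f : A -> C) l : (forall x, In x l -> f x <> 0) ->
  Cprod (map f l) <> 0.
Proof.
induction l as [|a l IH]; simpl; intros H. apply C1_nz.
apply Cmult_neq_0; auto.
Qed.

Lemma Cprod_map_mult {A} (f g : A -> C) l :
  Cprod (map (fun x => f x * g x) l) = Cprod (map f l) * Cprod (map g l).
Proof.
induction l as [|a l IH]; simpl. now rewrite Cmult_1_l. rewrite IH; ring.
Qed.

Lemma Cprod_map_inv {A} (f : A -> C) l :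
  Cprod (map (fun x => / f x) l) = / Cprod (map f l).
Proof.
induction l as [|a l IH]; simpl. field. rewrite IH. now rewrite Cinv_mult_total.
Qed.

Section Limits.
Context {T : Type} (F : (T -> Prop) -> Prop) {FF : Filter F}.
Implicit Types f g : T -> C.
Implicit Types l lf lg : C.

(** The uniform structure of [C] is that of a product, so limits may be taken on
    real and imaginary parts; the next lemma gives the version with the modulus. *)
Lemma filterlim_C_components f l :
  filterlim f F (locally l) <->
  filterlim (fun x => Re (f x)) F (locally (Re l)) /\
  filterlim (fun x => Im (f x)) F (locally (Im l)).
Proof.
rewrite !filterlim_locally. split.
- intros H; split; intros eps; generalize (H eps); apply filter_imp; intros x [H1 H2]; auto.
- intros [H1 H2] eps. generalize (filter_and _ _ (H1 eps) (H2 eps)).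
  apply filter_imp; intros x [? ?]; split; auto.
Qed.

Lemma filterlim_C_Cmod f l :
  filterlim f F (locally l) <-> forall eps : R, (0 < eps)%R ->
    F (fun x => (Cmod (f x - l) < eps)%R).
Proof.
split.
- rewrite filterlim_locally. intros H eps He.
  assert (Hs : (0 < eps / 2)%R) by lra.
  generalize (H (mkposreal _ Hs)). apply filter_imp. intros x [H1 H2].
  change (Rabs (Re (f x) - Re l) < eps / 2)%R in H1.
  change (Rabs (Im (f x) - Im l) < eps / 2)%R in H2.
  eapply Rle_lt_trans; [apply Cmod_2Rmax|].
  replace (fst (f x - l)) with (Re (f x) - Re l)%R by reflexivity.
  replace (snd (f x - l)) with (Im (f x) - Im l)%R by reflexivity.
  assert (sqrt 2 <= 2)%R.
  { rewrite <- (sqrt_square 2) at 2 by lra. apply sqrt_le_1_alt. lra. }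
  assert (0 <= sqrt 2)%R by apply sqrt_pos.
  apply Rle_lt_trans with (2 * Rmax (Rabs (Re (f x) - Re l)) (Rabs (Im (f x) - Im l)))%R.
  { apply Rmult_le_compat_r; auto. eapply Rle_trans; [apply Rabs_pos|apply Rmax_l]. }
  unfold Rmax; destruct (Rle_dec _ _); lra.
- intros H. apply filterlim_locally. intros eps.
  generalize (H eps (cond_pos eps)). apply filter_imp. intros x Hx.
  apply C_NormedModule_mixin_compat1. exact Hx.
Qed.

Lemma filterlim_C_const (c : C) : filterlim (fun _ : T => c) F (locally c).
Proof. apply filterlim_const. Qed.

Lemma filterlim_R_mult (f g : T -> R) (lf lg : R) :
  filterlim f F (locally lf) -> filterlim g F (locally lg) ->
  filterlim (fun x => f x * g x)%R F (locally (lf * lg)%R).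
Proof.
intros. exact (filterlim_comp_2 f g Rmult H H0 (filterlim_mult (K := R_AbsRing) lf lg)).
Qed.

Lemma filterlim_R_plus (f g : T -> R) (lf lg : R) :
  filterlim f F (locally lf) -> filterlim g F (locally lg) ->
  filterlim (fun x => f x + g x)%R F (locally (lf + lg)%R).
Proof.
intros. exact (filterlim_comp_2 f g Rplus H H0
  (filterlim_plus (V := R_NormedModule) lf lg)).
Qed.

Lemma filterlim_R_opp (f : T -> R) (lf : R) :
  filterlim f F (locally lf) -> filterlim (fun x => - f x)%R F (locally (- lf)%R).
Proof.
intros. exact (filterlim_comp _ _ _ f Ropp _ _ _ H
  (filterlim_opp (V := R_NormedModule) lf)).
Qed.

Lemma filterlim_R_inv (f : T -> R) (lf : R) : lf <> 0%R ->
  filterlim f F (locally lf) -> filterlim (fun x => / f x)%R F (locally (/ lf)%R).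
Proof.
intros Hl H. apply filterlim_comp with (1 := H). now apply continuous_Rinv.
Qed.

Lemma filterlim_C_plus f g lf lg :
  filterlim f F (locally lf) -> filterlim g F (locally lg) ->
  filterlim (fun x => f x + g x) F (locally (lf + lg)).
Proof.
rewrite !filterlim_C_components. intros [A1 A2] [B1 B2].
unfold Re, Im in *; split; simpl; apply filterlim_R_plus; auto.
Qed.

Lemma filterlim_C_opp f lf :
  filterlim f F (locally lf) -> filterlim (fun x => - f x) F (locally (- lf)).
Proof.
rewrite !filterlim_C_components. intros [A1 A2].
unfold Re, Im in *; split; simpl; apply filterlim_R_opp; auto.
Qed.

Lemma filterlim_C_minus f g lf lg :
  filterlim f F (locally lf) -> filterlim g F (locally lg) ->
  filterlim (fun x => f x - g x) F (locally (lf - lg)).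
Proof. intros; apply filterlim_C_plus; auto. now apply filterlim_C_opp. Qed.

Lemma filterlim_C_mult f g lf lg :
  filterlim f F (locally lf) -> filterlim g F (locally lg) ->
  filterlim (fun x => f x * g x) F (locally (lf * lg)).
Proof.
rewrite !filterlim_C_components. intros [A1 A2] [B1 B2]. unfold Re, Im in *; simpl.
split.
- apply filterlim_R_plus. now apply filterlim_R_mult. apply filterlim_R_opp.
  now apply filterlim_R_mult.
- apply filterlim_R_plus; now apply filterlim_R_mult.
Qed.

Lemma filterlim_C_inv f lf : lf <> 0 ->
  filterlim f F (locally lf) -> filterlim (fun x => / f x) F (locally (/ lf)).
Proof.
intros Hl H. apply filterlim_C_components in H as [A1 A2]. apply filterlim_C_components.
unfold Re, Im in *; simpl.
assert (Hn : (fst lf * (fst lf * 1) + snd lf * (snd lf * 1) <> 0)%R).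
{ intros E. apply Hl. apply C_eq; unfold Re, Im; simpl; nra. }
assert (Hd : filterlim (fun x =>
  / (fst (f x) * (fst (f x) * 1) + snd (f x) * (snd (f x) * 1)))%R F
   (locally (/ (fst lf * (fst lf * 1) + snd lf * (snd lf * 1)))%R)).
{ apply filterlim_R_inv; auto.
  apply filterlim_R_plus; repeat apply filterlim_R_mult; auto; apply filterlim_const. }
split; apply filterlim_R_mult; auto. now apply filterlim_R_opp.
Qed.

Lemma filterlim_Cexp f lf :
  filterlim f F (locally lf) -> filterlim (fun x => Cexp (f x)) F (locally (Cexp lf)).
Proof.
rewrite !filterlim_C_components. intros [A1 A2]. unfold Cexp, Re, Im in *; simpl.
assert (H1 : filterlim (fun x => exp (fst (f x))) F (locally (exp (fst lf)))).
{ apply filterlim_comp with (1 := A1). apply (continuous_exp (fst lf)). }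
split; apply filterlim_R_mult; auto; apply filterlim_comp with (1 := A2).
apply (continuous_cos (snd lf)). apply (continuous_sin (snd lf)).
Qed.

Lemma filterlim_Cprod {A} (f : A -> T -> C) (l : A -> C) xs :
  (forall x, In x xs -> filterlim (f x) F (locally (l x))) ->
  filterlim (fun t => Cprod (map (fun x => f x t) xs)) F (locally (Cprod (map l xs))).
Proof.
induction xs as [|a xs IH]; simpl; intros H. apply filterlim_C_const.
apply filterlim_C_mult; auto.
Qed.

End Limits.

Lemma filterlim_C_unique {T} (F : (T -> Prop) -> Prop) {FF : ProperFilter F} (f : T -> C)
  (l1 l2 : C) :
  filterlim f F (locally l1) -> filterlim f F (locally l2) -> l1 = l2.
Proof.
intros H1 H2. destruct (Ceq_dec l1 l2) as [E|E]; auto. exfalso.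
assert (Hd : (0 < Cmod (l1 - l2))%R) by now apply Cmod_gt_0, Cminus_eq_contra.
assert (FF' : Filter F) by apply filter_filter.
generalize (proj1 (filterlim_C_Cmod F f l1) H1) (proj1 (filterlim_C_Cmod F f l2) H2).
clear H1 H2; intros H1 H2.
destruct (filter_ex _ (filter_and (F := F) _ _ (H1 (Cmod (l1 - l2) / 2)%R ltac:(lra))
  (H2 (Cmod (l1 - l2) / 2)%R ltac:(lra)))) as [x [X1 X2]].
assert (Cmod (l1 - l2) <= Cmod (f x - l1) + Cmod (f x - l2))%R.
{ replace (l1 - l2) with (- (f x - l1) + (f x - l2)) by ring.
  eapply Rle_trans; [apply Cmod_triangle|]. rewrite Cmod_opp. lra. }
lra.
Qed.

Lemma Clim_unique (u : nat -> C) (l : C) : filterlim u eventually (locally l) -> Clim u = l.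
Proof.
intros H. apply filterlim_C_components in H. 2: apply eventually_filter.
destruct H as [H1 H2].
unfold Clim.
rewrite (is_lim_seq_unique _ (Finite (Re l)) H1), (is_lim_seq_unique _ (Finite (Im l)) H2).
now destruct l.
Qed.

(** * Infinite products *)

(** If [p (m + 1) = p m * f m] and [f m - 1] is bounded by
    [K / ((m + 1) (m + 2)) = K / (m + 1) - K / (m + 2)], the bounds telescope. *)
Lemma product_tail_bound (p f : nat -> C) (K : R) (n : nat) :
  (forall m, (n <= m)%nat -> p (S m) = p m * f m) ->
  (forall m, (n <= m)%nat -> (Cmod (f m - 1) <= K / (INR (S m) * INR (S (S m))))%R) ->
  (2 * K <= INR (S n))%R ->
  forall m, (n <= m)%nat ->
    (Cmod (p m - p n) <= Cmod (p n) * (2 * (K / INR (S n) - K / INR (S m))))%R.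
Proof.
intros Hp Hf HK.
assert (HS : forall k, (0 < INR (S k))%R) by (intros; apply lt_0_INR; lia).
assert (K0 : (0 <= K)%R).
{ generalize (Rle_trans _ _ _ (Cmod_ge_0 _) (Hf n (Nat.le_refl n))); intros H.
  generalize (Rmult_lt_0_compat _ _ (HS n) (HS (S n))); intros H'.
  apply Rmult_le_compat_r with (r := (INR (S n) * INR (S (S n)))%R) in H; [|lra].
  unfold Rdiv in H. rewrite Rmult_assoc, Rinv_l in H; lra. }
intros m Hm. induction Hm as [|m Hm IH].
- replace (p n - p n) with (RtoC 0) by ring. rewrite Cmod_0. lra.
- rewrite Hp by auto.
  replace (p m * f m - p n) with ((p m - p n) + p m * (f m - 1)) by ring.
  eapply Rle_trans; [apply Cmod_triangle|]. rewrite Cmod_mult.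
  assert (Hpm : (Cmod (p m) <= 2 * Cmod (p n))%R).
  { replace (p m) with ((p m - p n) + p n) by ring.
    eapply Rle_trans; [apply Cmod_triangle|].
    assert (2 * (K / INR (S n) - K / INR (S m)) <= 1)%R.
    { assert (0 <= K / INR (S m))%R.
      { apply Rmult_le_pos; auto. left. now apply Rinv_0_lt_compat. }
      assert (K / INR (S n) <= 1 / 2)%R.
      { apply Rmult_le_reg_r with (INR (S n)); auto.
        unfold Rdiv; rewrite Rmult_assoc, Rinv_l; [lra|]. apply Rgt_not_eq, HS. }
      lra. }
    generalize (Cmod_ge_0 (p n)). intros.
    assert (Cmod (p n) * (2 * (K / INR (S n) - K / INR (S m))) <= Cmod (p n) * 1)%R.
    { now apply Rmult_le_compat_l. }
    lra. }
  assert (E : (K / (INR (S m) * INR (S (S m))) = K / INR (S m) - K / INR (S (S m)))%R).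
  { rewrite (S_INR (S m)). field. generalize (HS m) (HS (S m)). rewrite (S_INR (S m)). lra.
    }
  assert (Hd := Hf m Hm). rewrite E in Hd.
  assert (Cmod (p m) * Cmod (f m - 1) <= (2 * Cmod (p n))
    * (K / INR (S m) - K / INR (S (S m))))%R.
  { apply Rmult_le_compat; auto using Cmod_ge_0. }
  lra.
Qed.

(** Throughout the section, [p] is the sequence of partial products of the factors
    [f], up to its first term [p 0]; on every disc the factors are
    [1 + O(1 / n^2)] uniformly. *)
Section Products.
Context (f p : nat -> C -> C).
Context (Hp : forall n s, p (S n) s = p n s * f n s).
Context (Hf : forall r : R, exists (K : R) (N : nat),
  forall n s, (N <= n)%nat -> (Cmod s <= r)%R ->
  (Cmod (f n s - 1) <= K / (INR (S n) * INR (S (S n))))%R).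

Lemma product_uniform (r : R) : exists (K : R) (N : nat), (0 <= K)%R /\
  (2 * K <= INR (S N))%R /\
  forall n m s, (N <= n)%nat -> (n <= m)%nat -> (Cmod s <= r)%R ->
   (Cmod (p m s - p n s) <= Cmod (p n s) * (2 * (K / INR (S n))))%R.
Proof.
destruct (Hf r) as (K & N & H).
set (K' := Rmax K 0).
assert (HK' : (0 <= K')%R) by apply Rmax_r.
destruct (nfloor_ex (2 * K')%R) as [N' HN']; [lra|].
exists K', (max N N'). split; auto. split.
- apply Rle_trans with (INR (S N')). rewrite S_INR; lra. apply le_INR; lia.
- intros n m s Hn Hm Hs.
  eapply Rle_trans. apply (product_tail_bound (fun k => p k s) (fun k => f k s) K' n); auto.
  + intros k Hk. eapply Rle_trans. apply H; auto; lia.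
    apply Rmult_le_compat_r; [|apply Rmax_l].
    left; apply Rinv_0_lt_compat, Rmult_lt_0_compat; apply lt_0_INR; lia.
  + apply Rle_trans with (INR (S N')). rewrite S_INR; lra. apply le_INR; lia.
  + apply Rmult_le_compat_l. apply Cmod_ge_0.
    assert (0 <= K' / INR (S m))%R.
    { apply Rmult_le_pos; auto. left. apply Rinv_0_lt_compat, lt_0_INR; lia. }
    lra.
Qed.

Lemma small_index (A eps : R) (N : nat) : (0 < eps)%R -> (0 <= A)%R -> exists n,
  (N <= n)%nat /\ (A / INR (S n) < eps)%R.
Proof.
intros He HA. destruct (nfloor_ex (A / eps)%R) as [M HM].
{ apply Rmult_le_pos; auto. left; now apply Rinv_0_lt_compat. }
exists (max N M). split. lia.
assert (0 < INR (S (max N M)))%R by (apply lt_0_INR; lia).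
apply Rmult_lt_reg_r with (INR (S (max N M))); auto.
unfold Rdiv; rewrite Rmult_assoc, Rinv_l by lra. rewrite Rmult_1_r.
apply Rlt_le_trans with (eps * INR (S M))%R.
- rewrite S_INR. destruct HM as [_ HM]. apply Rmult_lt_compat_l with (r := eps) in HM; auto.
  replace (eps * (A / eps))%R with A in HM by (field; lra). lra.
- apply Rmult_le_compat_l. lra. apply le_INR; lia.
Qed.

Lemma product_converges s : filterlim (fun n => p n s) eventually
  (locally (Clim (fun n => p n s))).
Proof.
assert (Hc : forall eps : posreal, exists n, forall m m', (n <= m)%nat -> (n <= m')%nat ->
  (Cmod (p m s - p m' s) < eps)%R).
{ intros eps. destruct (product_uniform (Cmod s)) as (K & N & HK & HKN & H).
  set (A := (Cmod (p N s) * (1 + 2 * (K / INR (S N))))%R).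
  assert (HKN0 : (0 <= K / INR (S N))%R).
  { apply Rmult_le_pos; auto. left. apply Rinv_0_lt_compat, lt_0_INR; lia. }
  assert (HA : forall n, (N <= n)%nat -> (Cmod (p n s) <= A)%R).
  { intros n Hn. replace (p n s) with ((p n s - p N s) + p N s) by ring.
    eapply Rle_trans; [apply Cmod_triangle|].
    generalize (H N n s (Nat.le_refl _) Hn (Rle_refl _)).
    unfold A. lra. }
  assert (A0 : (0 <= A)%R) by (generalize (HA N (Nat.le_refl _)) (Cmod_ge_0 (p N s)); lra).
  destruct (small_index (A * (2 * K)) (eps / 2) N) as (n & Hn & Hne).
  { generalize (cond_pos eps); lra. }
  { apply Rmult_le_pos; lra. }
  exists n.
  assert (Hm : forall m, (n <= m)%nat -> (Cmod (p m s - p n s) < eps / 2)%R).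
  { intros m Hm. eapply Rle_lt_trans. apply (H n m s); auto. lra.
    eapply Rle_lt_trans; [|exact Hne].
    replace (A * (2 * K) / INR (S n))%R with (A * (2 * (K / INR (S n))))%R
      by (field; apply Rgt_not_eq, lt_0_INR; lia).
    apply Rmult_le_compat_r; auto.
    assert (0 <= K / INR (S n))%R.
    { apply Rmult_le_pos; auto. left. apply Rinv_0_lt_compat, lt_0_INR; lia. }
    lra. }
  intros m m' H1 H2.
  replace (p m s - p m' s) with ((p m s - p n s) + - (p m' s - p n s)) by ring.
  eapply Rle_lt_trans; [apply Cmod_triangle|]. rewrite Cmod_opp.
  generalize (Hm m H1) (Hm m' H2). lra. }
assert (H1 : ex_finite_lim_seq (fun n => Re (p n s))).
{ apply ex_lim_seq_cauchy_corr. intros eps. destruct (Hc eps) as [n Hn]. exists n.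
  intros m m' h h'.
  eapply Rle_lt_trans; [|apply (Hn m m' h h')].
  eapply Rle_trans; [|apply re_le_Cmod]. right; reflexivity. }
assert (H2 : ex_finite_lim_seq (fun n => Im (p n s))).
{ apply ex_lim_seq_cauchy_corr. intros eps. destruct (Hc eps) as [n Hn]. exists n.
  intros m m' h h'.
  eapply Rle_lt_trans; [|apply (Hn m m' h h')].
  eapply Rle_trans; [|apply Rmax_Cmod]. eapply Rle_trans; [|apply Rmax_r].
  right; reflexivity. }
apply filterlim_C_components. apply eventually_filter.
destruct H1 as [l1 H1], H2 as [l2 H2].
unfold Clim. cbn [Re Im fst snd].
rewrite (is_lim_seq_unique _ _ H1), (is_lim_seq_unique _ _ H2). split; assumption.
Qed.

Lemma filterlim_Cmod_le {T} (F : (T -> Prop) -> Prop) {FF : ProperFilter F} (u : T -> C)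
  (l a : C) (b : R) :
  filterlim u F (locally l) -> F (fun x => Cmod (u x - a) <= b)%R -> (Cmod (l - a) <= b)%R.
Proof.
intros H Hb. apply Rnot_lt_le. intros Hlt.
assert (He : (0 < Cmod (l - a) - b)%R) by lra.
assert (FF' : Filter F) by apply filter_filter.
generalize (proj1 (filterlim_C_Cmod F u l) H _ He). clear H; intros H.
destruct (filter_ex _ (filter_and _ _ H Hb)) as [x [H1 H2]].
assert (Cmod (l - a) <= Cmod (u x - l) + Cmod (u x - a))%R.
{ replace (l - a) with (- (u x - l) + (u x - a)) by ring.
  eapply Rle_trans; [apply Cmod_triangle|]. rewrite Cmod_opp. lra. }
lra.
Qed.

Lemma product_limit_bound (r : R) : exists (K : R) (N : nat), (0 <= K)%R /\
  (2 * K <= INR (S N))%R /\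
  (forall n m s, (N <= n)%nat -> (n <= m)%nat -> (Cmod s <= r)%R ->
   (Cmod (p m s - p n s) <= Cmod (p n s) * (2 * (K / INR (S n))))%R) /\
  forall n s, (N <= n)%nat -> (Cmod s <= r)%R ->
   (Cmod (Clim (fun m => p m s) - p n s) <= Cmod (p n s) * (2 * (K / INR (S n))))%R.
Proof.
destruct (product_uniform r) as (K & N & H0 & H1 & H).
exists K, N. repeat split; auto. intros n s Hn Hs.
apply (filterlim_Cmod_le eventually (fun m => p m s)). apply product_converges.
exists n. intros; apply H; auto.
Qed.

Lemma product_limit_neq_0 s : (forall n, p n s <> 0) -> Clim (fun n => p n s) <> 0.
Proof.
intros Hn E. destruct (product_limit_bound (Cmod s)) as (K & N & H0 & H1 & _ & H).
destruct (small_index K (1/2) N) as (n & HN & Hs); try lra.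
specialize (H n s HN (Rle_refl _)). rewrite E in H.
replace (0 - p n s) with (- p n s) in H by ring. rewrite Cmod_opp in H.
generalize (proj1 (Cmod_gt_0 _) (Hn n)). intros.
assert (Cmod (p n s) * (2 * (K / INR (S n))) < Cmod (p n s) * 1)%R.
{ apply Rmult_lt_compat_l; lra. }
lra.
Qed.

Lemma product_limit_continuous s :
  (forall n, filterlim (p n) (locally s) (locally (p n s))) ->
  filterlim (fun s => Clim (fun n => p n s)) (locally s) (locally (Clim (fun n => p n s))).
Proof.
intros Hc. destruct (product_limit_bound (Cmod s + 1)) as (K & N & H0 & H1 & HN & H).
set (A := (2 * (Cmod (p N s) + 1))%R).
assert (A0 : (0 < A)%R) by (unfold A; generalize (Cmod_ge_0 (p N s)); lra).
apply filterlim_C_Cmod. apply locally_filter. intros eps He.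
destruct (small_index (A * (2 * K)) (eps / 3) N) as (n & Hn & Hne).
{ lra. } { apply Rmult_le_pos; lra. }
assert (HcN := proj1 (filterlim_C_Cmod _ _ _) (Hc N) 1%R Rlt_0_1).
assert (Hcn := proj1 (filterlim_C_Cmod _ _ _) (Hc n) (eps / 3)%R ltac:(lra)).
assert (Hid := proj1 (filterlim_C_Cmod _ _ _) (filterlim_id _ (locally s)) 1%R Rlt_0_1).
assert (Hb : forall t, (Cmod t <= Cmod s + 1)%R -> (Cmod (p N t - p N s) < 1)%R ->
  (Cmod (Clim (fun m => p m t) - p n t) < eps / 3)%R).
{ intros t Ht Hpt.
  eapply Rle_lt_trans. apply H; auto.
  eapply Rle_lt_trans; [|exact Hne].
  replace (A * (2 * K) / INR (S n))%R with (A * (2 * (K / INR (S n))))%R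
    by (field; apply Rgt_not_eq, lt_0_INR; lia).
  assert (0 <= K / INR (S n))%R.
  { apply Rmult_le_pos; auto. left. apply Rinv_0_lt_compat, lt_0_INR; lia. }
  apply Rmult_le_compat_r. lra.
  assert (Cmod (p N t) <= Cmod (p N s) + 1)%R.
  { replace (p N t) with ((p N t - p N s) + p N s) by ring.
    eapply Rle_trans; [apply Cmod_triangle|]. lra. }
  assert (K / INR (S N) <= 1 / 2)%R.
  { assert (0 < INR (S N))%R by (apply lt_0_INR; lia).
    apply Rmult_le_reg_r with (INR (S N)); auto.
    unfold Rdiv; rewrite Rmult_assoc, Rinv_l; lra. }
  replace (p n t) with ((p n t - p N t) + p N t) by ring.
  eapply Rle_trans; [apply Cmod_triangle|].
  specialize (HN N n t (Nat.le_refl _) Hn Ht).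
  assert (Cmod (p N t) * (2 * (K / INR (S N))) <= Cmod (p N t) * 1)%R.
  { apply Rmult_le_compat_l. apply Cmod_ge_0. lra. }
  unfold A. lra. }
generalize (filter_and _ _ HcN (filter_and _ _ Hcn Hid)).
apply filter_imp. intros t (T1 & T2 & T3).
assert (Ht : (Cmod t <= Cmod s + 1)%R).
{ replace t with ((t - s) + s) by ring. eapply Rle_trans; [apply Cmod_triangle|]. lra. }
assert (B1 := Hb t Ht T1).
assert (B2 : (Cmod (Clim (fun m => p m s) - p n s) < eps / 3)%R).
{ apply Hb. lra. replace (p N s - p N s) with (RtoC 0) by ring. rewrite Cmod_0; lra. }
replace (Clim (fun m => p m t) - Clim (fun m => p m s)) with
 ((Clim (fun m => p m t) - p n t) + ((p n t - p n s) + - (Clim (fun m => p m s) - p n s)))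
   by ring.
eapply Rle_lt_trans; [apply Cmod_triangle|].
eapply Rle_lt_trans; [apply Rplus_le_compat_l, Cmod_triangle|].
rewrite Cmod_opp. lra.
Qed.

End Products.

(** * Estimates of the factors *)

Lemma RtoC_neq (x y : R) : x <> y -> RtoC x <> RtoC y.
Proof. intros H E. now apply H, RtoC_inj. Qed.

Lemma mean_value_bound (u du : R -> R) (x M : R) : (0 <= x)%R ->
  (forall t, (0 <= t <= x)%R -> is_derive u t (du t)) ->
  (forall t, (0 <= t <= x)%R -> (Rabs (du t) <= M)%R) ->
  (Rabs (u x - u 0) <= M * x)%R.
Proof.
intros Hx Hd Hb.
destruct (MVT_gen u 0 x du) as (c & Hc & E).
- rewrite Rmin_left, Rmax_right by auto. intros; apply Hd; lra.
- rewrite Rmin_left, Rmax_right by auto. intros t Ht. apply continuity_pt_filterlim.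
  apply (ex_derive_continuous (V := R_NormedModule) u). eexists; now apply Hd.
- rewrite Rmin_left, Rmax_right in Hc by auto. rewrite E, Rabs_mult.
  replace (Rabs (x - 0)) with x by (rewrite Rabs_right; lra).
  apply Rmult_le_compat_r; auto.
Qed.

Lemma Cmod_le_Re_Im (z : C) : (Cmod z <= Rabs (Re z) + Rabs (Im z))%R.
Proof.
replace z with (RtoC (Re z) + Ci * RtoC (Im z)) at 1
 by (apply C_eq; unfold Re, Im; simpl; ring).
eapply Rle_trans; [apply Cmod_triangle|].
rewrite Cmod_mult, !Cmod_R, Cmod_Ci. lra.
Qed.

Lemma im_le_Cmod (z : C) : (Rabs (Im z) <= Cmod z)%R.
Proof. eapply Rle_trans; [|apply Rmax_Cmod]. apply Rmax_r. Qed.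

(** The factor 2 comes from estimating real and imaginary parts separately. *)
Lemma mean_value_C (h dh : R -> C) (x M : R) : (0 <= x)%R ->
  (forall t, (0 <= t <= x)%R -> is_derive (fun t => Re (h t)) t (Re (dh t))) ->
  (forall t, (0 <= t <= x)%R -> is_derive (fun t => Im (h t)) t (Im (dh t))) ->
  (forall t, (0 <= t <= x)%R -> (Cmod (dh t) <= M)%R) ->
  (Cmod (h x - h 0%R) <= 2 * M * x)%R.
Proof.
intros Hx H1 H2 Hb. eapply Rle_trans; [apply Cmod_le_Re_Im|].
assert (A1 := mean_value_bound _ _ x M Hx H1).
assert (A2 := mean_value_bound _ _ x M Hx H2).
assert (B1 : (Rabs (Re (h x) - Re (h 0%R)) <= M * x)%R).
{ apply A1. intros t Ht. eapply Rle_trans; [apply re_le_Cmod|auto]. }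
assert (B2 : (Rabs (Im (h x) - Im (h 0%R)) <= M * x)%R).
{ apply A2. intros t Ht. eapply Rle_trans; [apply im_le_Cmod|auto]. }
replace (Re (h x - h 0%R)) with (Re (h x) - Re (h 0%R))%R by reflexivity.
replace (Im (h x - h 0%R)) with (Im (h x) - Im (h 0%R))%R by reflexivity.
lra.
Qed.

(** With [x = 1 / j], the left-hand side concerns the [j]-th factor
    [(1 + s / j) (1 - 1 / j)^s] of the reciprocal gamma function. *)
Lemma gauss_factor_bound (s : C) (r x : R) : (Cmod s <= r)%R -> (0 <= x <= 1/2)%R ->
  (Cmod ((1 + s * x) * Cexp (s * ln (1 - x)) - 1) <= 4 * (r * (1 + r)) * exp r * (x * x))%R.
Proof.
intros Hs Hx.
assert (Hr : (0 <= r)%R) by (generalize (Cmod_ge_0 s); lra).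
set (h := fun t : R => (1 + s * t) * Cexp (s * ln (1 - t))).
(* [dh] is the derivative of [h]; it vanishes at [0], whence the square. *)
set (dh := fun t : R => RtoC (- (t / (1 - t)))%R * (s * (1 + s)) * Cexp (s * ln (1 - t))).
assert (E0 : h 0%R = 1).
{ unfold h. replace (1 - 0)%R with 1%R by ring. rewrite ln_1, !Cmult_0_r, Cexp_0. ring. }
replace (Cmod _) with (Cmod (h x - h 0%R)) by (rewrite E0; reflexivity).
eapply Rle_trans. apply (mean_value_C h dh x (2 * (r * (1 + r)) * exp r * x)); try lra.
- intros t Ht. destruct s as [a b]. unfold h, dh, Cexp, Re, Im; simpl.
  auto_derive. repeat split; lra.
  unfold Rminus. field. lra.
- intros t Ht. destruct s as [a b]. unfold h, dh, Cexp, Re, Im; simpl.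
  auto_derive. repeat split; lra.
  unfold Rminus. field. lra.
- intros t Ht. unfold dh. rewrite !Cmod_mult, Cmod_Cexp, Cmod_R, Rabs_Ropp.
  assert (Ht1 : (0 <= t / (1 - t) <= 2 * x)%R).
  { split. apply Rmult_le_pos. lra. left; apply Rinv_0_lt_compat; lra.
    apply Rmult_le_reg_r with (1 - t)%R. lra. unfold Rdiv; rewrite Rmult_assoc, Rinv_l; nra.
    }
  rewrite (Rabs_pos_eq (t / (1-t))) by lra.
  assert (Hw : (Cmod s * Cmod (1 + s) <= r * (1 + r))%R).
  { apply Rmult_le_compat; auto using Cmod_ge_0.
    eapply Rle_trans; [apply Cmod_triangle|]. rewrite Cmod_1. lra. }
  assert (Hl : (Rabs (ln (1 - t)) <= 1)%R).
  { rewrite Rabs_left1.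
    - rewrite <- ln_Rinv by lra. apply Rle_trans with (ln (exp 1)); [|rewrite ln_exp; lra].
      apply ln_le. apply Rinv_0_lt_compat; lra.
      apply Rle_trans with 2%R.
      + replace 2%R with (/ (1/2))%R by field. apply Rinv_le_contravar; lra.
      + generalize (exp_ineq1_le 1). lra.
    - rewrite <- ln_1. apply ln_le; lra. }
  assert (He : (exp (Re (s * ln (1 - t))) <= exp r)%R).
  { assert (Re (s * ln (1 - t)) <= r)%R.
    { eapply Rle_trans; [apply Rle_abs|]. eapply Rle_trans; [apply re_le_Cmod|].
      rewrite Cmod_mult, Cmod_R. generalize (Cmod_ge_0 s) (Rabs_pos (ln (1-t))). nra. }
    destruct H as [H| ->]. left; now apply exp_increasing. lra. }
  replace (2 * (r * (1 + r)) * exp r * x)%R with (2 * x * (r * (1 + r)) * exp r)%R by ring.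
  apply Rmult_le_compat; auto.
  + apply Rmult_le_pos. lra. apply Rmult_le_pos; apply Cmod_ge_0.
  + left; apply exp_pos.
  + apply Rmult_le_compat; auto. lra. apply Rmult_le_pos; apply Cmod_ge_0. lra.
- right; ring.
Qed.

(** The genus two Weierstrass factor is [1 + O(z^3)]. *)
Lemma weierstrass_factor_bound (z : C) : (Cmod z <= 1)%R ->
  (Cmod ((1 + z) * Cexp (- z + z ^ 2 / 2) - 1) <= 2 * exp 2 * Cmod z ^ 3)%R.
Proof.
intros Hz.
set (h := fun t : R => (1 + z * t) * Cexp (- (z * t) + (z * t) ^ 2 / 2)).
(* In the derivative [dh] of [h] the terms of order below [3] in [z] cancel. *)
set (dh := fun t : R => RtoC (t * t) * z ^ 3 * Cexp (- (z * t) + (z * t) ^ 2 / 2)).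
assert (HE : forall t : R, - (z * t) + (z * t) ^ 2 / 2 =
  (- Re z * t + (Re z ^ 2 - Im z ^ 2) / 2 * t ^ 2, - Im z * t + Re z * Im z * t ^ 2)%R).
{ intros t. destruct z as [a b]. apply C_eq; unfold Re, Im; simpl; field. }
assert (E0 : h 0%R = 1).
{ unfold h. replace (- (z * 0%R) + (z * 0%R) ^ 2 / 2) with (RtoC 0)
    by (field; apply RtoC_neq; lra).
  rewrite Cexp_0. ring. }
assert (E1 : h 1%R = (1 + z) * Cexp (- z + z ^ 2 / 2)).
{ unfold h. now rewrite Cmult_1_r. }
rewrite <- E1, <- E0.
eapply Rle_trans. apply (mean_value_C h dh 1%R (exp 2 * Cmod z ^ 3)); try lra.
- intros t Ht. unfold dh. rewrite HE. destruct z as [a b].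
  apply is_derive_ext with (fun t => exp (- a * t + (a ^ 2 - b ^ 2) / 2 * t ^ 2) *
    ((1 + a * t) * cos (- b * t + a * b * t ^ 2) - b * t
      * sin (- b * t + a * b * t ^ 2)))%R.
  { intros u. unfold h. rewrite HE. unfold Cexp, Re, Im; simpl. ring. }
  unfold Cexp, Re, Im; simpl. auto_derive. auto. unfold Rdiv, Rminus; simpl. field.
- intros t Ht. unfold dh. rewrite HE. destruct z as [a b].
  apply is_derive_ext with (fun t => exp (- a * t + (a ^ 2 - b ^ 2) / 2 * t ^ 2) *
    ((1 + a * t) * sin (- b * t + a * b * t ^ 2) + b * t
      * cos (- b * t + a * b * t ^ 2)))%R.
  { intros u. unfold h. rewrite HE. unfold Cexp, Re, Im; simpl. ring. }
  unfold Cexp, Re, Im; simpl. auto_derive. auto. unfold Rdiv, Rminus; simpl. field.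
- intros t Ht. unfold dh. rewrite !Cmod_mult, Cmod_Cexp, Cmod_R, Cmod_pow.
  assert (He : (exp (Re (- (z * t) + (z * t) ^ 2 / 2)) <= exp 2)%R).
  { assert (Hzt : (Cmod (z * t) <= 1)%R).
    { rewrite Cmod_mult, Cmod_R, Rabs_pos_eq by lra. generalize (Cmod_ge_0 z); nra. }
    assert (Re (- (z * t) + (z * t) ^ 2 / 2) <= 2)%R.
    { eapply Rle_trans; [apply Rle_abs|]. eapply Rle_trans; [apply re_le_Cmod|].
      eapply Rle_trans; [apply Cmod_triangle|].
      rewrite Cmod_opp, Cmod_div, Cmod_pow, Cmod_R, Rabs_pos_eq; try lra.
      generalize (Cmod_ge_0 (z * t)). simpl. intros. nra. apply RtoC_neq; lra. }
    destruct H as [H| ->]. left; now apply exp_increasing. lra. }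
  rewrite Rabs_pos_eq by nra.
  generalize (pow_le _ 3 (Cmod_ge_0 z)). intros H3.
  generalize (exp_pos (Re (- (z * t) + (z * t) ^ 2 / 2))). intros.
  assert (0 <= t * t <= 1)%R by nra.
  assert (t * t * Cmod z ^ 3 <= 1 * Cmod z ^ 3)%R by (apply Rmult_le_compat_r; lra).
  assert (0 <= t * t * Cmod z ^ 3)%R by (apply Rmult_le_pos; lra).
  rewrite Rmult_comm. apply Rmult_le_compat; auto; lra.
- lra.
Qed.

(** * The gamma function *)

(** The reciprocal of Gauss's quotient [n! n^s / (s (s + 1) ... (s + n))]. *)
Definition rgauss (n : nat) (s : C) : C :=
  Cprod (map (fun j => s + INR j) (seq 0 (S n)))
  / (INR (fact n) * Cexp (s * ln (INR n))).

(** The reciprocal gamma function.  The sequence starts at [n = 1], where the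
    quotient of consecutive terms takes the form [gauss_factor]: the term [n = 0]
    involves [ln 0]. *)
Definition rGamma (s : C) : C := Clim (fun n => rgauss (S n) s).

(** The quotient of two consecutive terms, see [rgauss_S]; [n + 2] is the index of
    the new factor [s + n + 2]. *)
Definition gauss_factor (n : nat) (s : C) : C :=
  (1 + s * (/ INR (n + 2))%R) * Cexp (s * ln (1 - / INR (n + 2))).

Lemma C_fact_neq_0 n : RtoC (INR (fact n)) <> 0.
Proof. apply RtoC_neq, INR_fact_neq_0. Qed.

Lemma rgauss_S n s : rgauss (S (S n)) s = rgauss (S n) s * gauss_factor n s.
Proof.
unfold rgauss, gauss_factor.
rewrite (seq_S (S (S n)) 0), map_app, Cprod_app. cbn [map]. rewrite Cprod_cons, Cprod_nil.
replace (0 + S (S n))%nat with (S (S n)) by lia. replace (n + 2)%nat with (S (S n)) by lia.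
assert (H1 : (0 < INR (S n))%R) by (apply lt_0_INR; lia).
assert (H2 : (0 < INR (S (S n)))%R) by (apply lt_0_INR; lia).
replace (1 - / INR (S (S n)))%R with (INR (S n) * / INR (S (S n)))%R.
2:{ rewrite (S_INR (S n)). field. rewrite S_INR in H2. lra. }
rewrite ln_mult, ln_Rinv; auto using Rinv_0_lt_compat.
change (fact (S (S n))) with (S (S n) * fact (S n))%nat. rewrite mult_INR.
rewrite RtoC_mult, RtoC_plus, RtoC_opp, RtoC_inv by lra.
rewrite Cmult_plus_distr_l, Cexp_plus.
replace (s * - ln (INR (S (S n)))) with (- (s * ln (INR (S (S n))))) by ring.
rewrite Cexp_opp.
assert (A1 := Cexp_neq_0 (s * ln (INR (S n)))).
assert (A2 := Cexp_neq_0 (s * ln (INR (S (S n))))).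
assert (A3 := C_fact_neq_0 (S n)).
assert (A4 : RtoC (INR (S (S n))) <> 0) by (apply RtoC_neq; lra).
set (X := Cprod _). clearbody X. field. repeat split; auto.
Qed.

Lemma gauss_factor_near_1 (r : R) : exists (K : R) (N : nat), forall n s, (N <= n)%nat ->
  (Cmod s <= r)%R ->
  (Cmod (gauss_factor n s - 1) <= K / (INR (S n) * INR (S (S n))))%R.
Proof.
exists (4 * (r * (1 + r)) * exp r)%R, O. intros n s _ Hs.
unfold gauss_factor. replace (n + 2)%nat with (S (S n)) by lia.
assert (H1 : (0 < INR (S n))%R) by (apply lt_0_INR; lia).
assert (H2 : (2 <= INR (S (S n)))%R) by (rewrite !S_INR; generalize (pos_INR n); lra).
assert (H3 : (INR (S n) <= INR (S (S n)))%R) by (apply le_INR; lia).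
assert (0 <= r)%R by (generalize (Cmod_ge_0 s); lra).
eapply Rle_trans. apply gauss_factor_bound. eassumption.
- split. left; apply Rinv_0_lt_compat; lra.
  replace (1/2)%R with (/2)%R by field. apply Rinv_le_contravar; lra.
- apply Rmult_le_compat_l.
  + apply Rmult_le_pos. apply Rmult_le_pos. lra. apply Rmult_le_pos; lra.
    left; apply exp_pos.
  + rewrite <- Rinv_mult. apply Rinv_le_contravar. apply Rmult_lt_0_compat; lra.
    apply Rmult_le_compat_r; lra.
Qed.

Lemma rgauss_lim s : filterlim (fun n => rgauss n s) eventually (locally (rGamma s)).
Proof.
assert (H := product_converges gauss_factor (fun n => rgauss (S n))
   (fun n s => rgauss_S n s) gauss_factor_near_1 s).
intros P HP. destruct (H P HP) as [N HN]. exists (S N). intros [|n] Hn; [lia|]. apply HN.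
lia.
Qed.

Lemma Gamma_rGamma_lim s : filterlim (fun n => / rgauss n s) eventually
  (locally (/ rGamma s)) ->
  Gamma s = / rGamma s.
Proof.
intros H. unfold Gamma. apply Clim_unique.
eapply filterlim_ext; [|exact H]. intros n. unfold rgauss.
unfold Cdiv. rewrite Cinv_mult_total, Cinv_inv_total. ring.
Qed.

Lemma shifted_neq_0 s k : ~ nonpos_int s -> s + INR k <> 0.
Proof.
intros H E. apply H. exists k. replace s with (s + INR k - INR k) by ring. rewrite E; ring.
Qed.

Lemma rgauss_neq_0 n s : ~ nonpos_int s -> rgauss n s <> 0.
Proof.
intros H. apply Cdiv_neq_0.
- apply Cprod_neq_0. intros; now apply shifted_neq_0.
- apply Cmult_neq_0. apply C_fact_neq_0. apply Cexp_neq_0.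
Qed.

Lemma rgauss_eq_0 n k : (k <= n)%nat -> rgauss n (- INR k) = 0.
Proof.
intros H. unfold rgauss.
destruct (in_split k (seq 0 (S n))) as (l1 & l2 & E). apply in_seq; lia.
rewrite E, map_app, Cprod_app. cbn [map]. rewrite Cprod_cons.
replace (- INR k + INR k) with (RtoC 0) by ring. unfold Cdiv. ring.
Qed.

Lemma rGamma_neq_0 s : ~ nonpos_int s -> rGamma s <> 0.
Proof.
intros H. unfold rGamma.
apply (product_limit_neq_0 gauss_factor (fun n => rgauss (S n))
   (fun n s => rgauss_S n s) gauss_factor_near_1 s). intros; now apply rgauss_neq_0.
Qed.

Lemma rGamma_pole k : rGamma (- INR k) = 0.
Proof.
apply (filterlim_C_unique eventually (fun n => rgauss n (- INR k))). apply rgauss_lim.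
apply filterlim_ext_loc with (fun _ => RtoC 0).
- exists k. intros; now rewrite rgauss_eq_0.
- apply filterlim_const.
Qed.

(** Valid at the poles too, where both sides are [0]. *)
Lemma Gamma_rGamma s : Gamma s = / rGamma s.
Proof.
apply Gamma_rGamma_lim.
destruct (Classical_Prop.classic (nonpos_int s)) as [[k ->]|H].
- apply filterlim_ext_loc with (fun _ => RtoC 0).
  + exists k. intros n Hn. now rewrite rgauss_eq_0, Cinv_0.
  + rewrite rGamma_pole, Cinv_0. apply filterlim_const.
- apply filterlim_C_inv. apply eventually_filter. now apply rGamma_neq_0. apply rgauss_lim.
Qed.

Lemma Gamma_neq_0 s : ~ nonpos_int s -> Gamma s <> 0.
Proof. intros H. rewrite Gamma_rGamma. apply Cinv_neq_0. now apply rGamma_neq_0. Qed.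

Lemma rgauss_continuous n s : filterlim (rgauss n) (locally s) (locally (rgauss n s)).
Proof.
unfold rgauss. assert (FF : Filter (locally s)) by apply locally_filter.
apply filterlim_C_mult; auto.
- apply (filterlim_Cprod (locally s) (fun j s => s + INR j)). intros.
  apply filterlim_C_plus; auto. apply filterlim_id. apply filterlim_C_const; auto.
- apply filterlim_C_inv; auto. apply Cmult_neq_0. apply C_fact_neq_0. apply Cexp_neq_0.
  apply filterlim_C_mult; auto. apply filterlim_C_const; auto.
  apply filterlim_Cexp; auto. apply filterlim_C_mult; auto. apply filterlim_id.
  apply filterlim_C_const; auto.
Qed.

Lemma rGamma_continuous s : filterlim rGamma (locally s) (locally (rGamma s)).
Proof.
apply (product_limit_continuous gauss_factor (fun n => rgauss (S n))
   (fun n s => rgauss_S n s) gauss_factor_near_1 s).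
intros n. apply rgauss_continuous.
Qed.

(** The functional equation of the gamma function, before passing to the limit. *)
Lemma rgauss_shift n s : (0 < n)%nat ->
  s * rgauss n (s + 1) = rgauss n s * (1 + (s + 1) * (/ INR n)%R).
Proof.
intros Hn. unfold rgauss.
assert (H1 : (0 < INR n)%R) by (apply lt_0_INR; lia).
rewrite Cmult_plus_distr_r, Cexp_plus, Cmult_1_l, Cexp_RtoC, exp_ln by auto.
assert (E : s * Cprod (map (fun j => s + 1 + INR j) (seq 0 (S n))) =
  Cprod (map (fun j => s + INR j) (seq 0 (S n))) * (s + 1 + INR n)).
{ rewrite (seq_S n 0) at 1. rewrite map_app, Cprod_app. cbn [map].
  rewrite Cprod_cons, Cprod_nil.
  replace (0 + n)%nat with n by lia.
  change (seq 0 (S n)) with (0%nat :: seq 1 n). cbn [map]. rewrite Cprod_cons.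
  rewrite <- seq_shift, map_map. simpl (INR 0).
  rewrite (map_ext (fun x => s + INR (S x)) (fun j => s + 1 + INR j)).
  ring. intros j. rewrite S_INR, RtoC_plus. ring. }
assert (A1 := Cexp_neq_0 (s * ln (INR n))).
assert (A3 := C_fact_neq_0 n).
assert (A4 : RtoC (INR n) <> 0) by (apply RtoC_neq; lra).
rewrite RtoC_inv by lra.
unfold Cdiv at 1. rewrite Cmult_assoc, E.
set (X := Cprod _). clearbody X. field. repeat split; auto.
Qed.

Lemma rGamma_shift s : rGamma s = s * rGamma (s + 1).
Proof.
symmetry. apply (filterlim_C_unique eventually (fun n => s * rgauss n (s + 1))).
- apply filterlim_C_mult. apply eventually_filter.
  apply filterlim_C_const, eventually_filter. apply rgauss_lim.
- apply filterlim_ext_loc with (fun n => rgauss n s * (1 + (s + 1) * (/ INR n)%R)).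
  { exists 1%nat. intros. symmetry; now apply rgauss_shift. }
  replace (rGamma s) with (rGamma s * (1 + (s + 1) * 0%R)) by ring.
  assert (FF : Filter eventually) by apply eventually_filter.
  apply filterlim_C_mult; auto. apply rgauss_lim.
  apply filterlim_C_plus; auto. apply filterlim_C_const; auto.
  apply filterlim_C_mult; auto. apply filterlim_C_const; auto.
  apply filterlim_C_components; auto. split; simpl.
  + apply (is_lim_seq_inv INR p_infty). apply is_lim_seq_INR. discriminate.
  + apply filterlim_const.
Qed.

Lemma Gamma_shift (s : C) : s <> 0 -> Gamma (s + 1) = s * Gamma s.
Proof.
intros H. rewrite !Gamma_rGamma, (rGamma_shift s), Cinv_mult_total.
rewrite Cmult_assoc, Cinv_r by assumption. now rewrite Cmult_1_l.
Qed.

(** * Residues of the hypergeometric kernel *)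

Lemma pochhammer_S x k : pochhammer x (S k) = pochhammer x k * (x + INR k).
Proof.
unfold pochhammer. rewrite seq_S, map_app, Cprod_app. cbn [map].
rewrite Cprod_cons, Cprod_nil.
simpl (0 + k)%nat. ring.
Qed.

Lemma pochhammer_S_l x k : pochhammer x (S k) = x * pochhammer (x + 1) k.
Proof.
unfold pochhammer. cbn [seq map]. rewrite Cprod_cons, <- seq_shift, map_map. simpl (INR 0).
rewrite (map_ext (fun j => x + INR (S j)) (fun j => x + 1 + INR j)). ring.
intros j. rewrite S_INR, RtoC_plus. ring.
Qed.

Lemma pochhammer_reflect x k : pochhammer (1 - x - INR k) k = (- (1)) ^ k * pochhammer x k.
Proof.
induction k as [|k IH].
- unfold pochhammer; simpl. ring.
- rewrite pochhammer_S_l, pochhammer_S.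
  replace (1 - x - INR (S k) + 1) with (1 - x - INR k) by (rewrite S_INR, RtoC_plus; ring).
  rewrite IH, Cpow_S, S_INR, RtoC_plus. ring.
Qed.

Lemma pochhammer_1 k : pochhammer 1 k = INR (fact k).
Proof.
induction k as [|k IH]. reflexivity.
rewrite pochhammer_S, IH. change (fact (S k)) with (S k * fact k)%nat.
rewrite mult_INR, S_INR, RtoC_mult, RtoC_plus. ring.
Qed.

Lemma pochhammer_neq_0 x k : ~ nonpos_int x -> pochhammer x k <> 0.
Proof. intros H. apply Cprod_neq_0. intros. now apply shifted_neq_0. Qed.

Lemma rGamma_pochhammer x k : rGamma x = pochhammer x k * rGamma (x + INR k).
Proof.
induction k as [|k IH].
- unfold pochhammer; simpl. rewrite Cplus_0_r. ring.
- rewrite IH, pochhammer_S, (rGamma_shift (x + INR k)), S_INR, RtoC_plus.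
  replace (x + INR k + 1) with (x + (INR k + 1)) by ring. ring.
Qed.

Lemma shifted_not_nonpos_int x k : ~ nonpos_int x -> ~ nonpos_int (x + INR k).
Proof.
intros H [j E]. apply H. exists (j + k)%nat. rewrite plus_INR, RtoC_plus.
replace x with (x + INR k - INR k) by ring. rewrite E; ring.
Qed.

Lemma nonpos_int_1 : ~ nonpos_int 1.
Proof.
intros [k E]. apply (f_equal Re) in E. simpl in E. generalize (pos_INR k). lra.
Qed.

Lemma Cprod_const {A} (c : C) (l : list A) : Cprod (map (fun _ => c) l) = c ^ length l.
Proof. induction l as [|a l IH]; simpl. reflexivity. now rewrite IH. Qed.

(** In [(s - k) Gamma(-s)] the zero of [s - k] cancels the factor [k - s] of
    [rGamma (- s) = (-s)(1 - s)...(k - s) rGamma (k + 1 - s)]. *)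
Lemma Gamma_residue k : filterlim (fun s => (s - INR k) * Gamma (0 - s))
  (locally' (RtoC (INR k)))
   (locally (- / rGamma 1 * (- (1)) ^ k / INR (fact k))).
Proof.
apply filterlim_ext_loc with (fun s => - / (pochhammer (- s) k * rGamma (- s + INR k + 1))).
- exists (mkposreal _ Rlt_0_1). intros s _ Hs.
  rewrite Gamma_rGamma. replace (0 - s) with (- s) by ring.
  rewrite (rGamma_pochhammer (- s) k), (rGamma_shift (- s + INR k)).
  rewrite !Cinv_mult_total.
  assert (E : (s - INR k) * / (- s + INR k) = - (1)).
  { field. intros E. apply Hs.
    assert (E' : @eq C s (RtoC (INR k))) by (replace s with (INR k - (- s + INR k)) by ring;
      rewrite E; ring).
    exact E'. }
  transitivity ((s - INR k) * / (- s + INR k)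
    * (/ pochhammer (- s) k * / rGamma (- s + INR k + 1))).
  + rewrite E. ring.
  + ring.
- replace (- / rGamma 1 * (- (1)) ^ k / INR (fact k)) with
    (- / (pochhammer (- INR k) k * rGamma (- INR k + INR k + 1))).
  2:{ replace (- INR k + INR k + 1) with (RtoC 1) by ring.
      replace (- INR k) with (1 - 1 - INR k) by ring.
      rewrite pochhammer_reflect, pochhammer_1, !Cinv_mult_total.
      rewrite <- Cpow_inv by (intros E; apply (f_equal Re) in E; simpl in E; lra).
      replace (/ - (1)) with (- (1)) by (field; apply RtoC_neq; lra). unfold Cdiv. ring. }
  apply (filterlim_filter_le_1 (F := locally (RtoC (INR k)))).
  { intros P HP. unfold locally', within. revert HP. apply filter_imp. auto. }
  assert (FF : Filter (locally (RtoC (INR k)))) by apply locally_filter.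
  assert (Hid : filterlim (fun s : C => - s) (locally (RtoC (INR k))) (locally (- INR k))).
  { apply filterlim_C_opp; auto. apply filterlim_id. }
  apply filterlim_C_opp; auto. apply filterlim_C_inv; auto.
  + apply Cmult_neq_0.
    * replace (- INR k) with (1 - 1 - INR k) by ring. rewrite pochhammer_reflect.
      apply Cmult_neq_0. apply Cpow_nz. intros E. apply (f_equal Re) in E. simpl in E. lra.
      apply pochhammer_neq_0, nonpos_int_1.
    * replace (- INR k + INR k + 1) with (RtoC 1) by ring. apply rGamma_neq_0, nonpos_int_1.
  + apply filterlim_C_mult; auto.
    * apply (filterlim_Cprod (locally (RtoC (INR k))) (fun j s => - s + INR j) (fun j =>
        - INR k + INR j)).
      intros. apply filterlim_C_plus; auto. apply filterlim_C_const; auto.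
    * apply filterlim_comp with (2 := rGamma_continuous (- INR k + INR k + 1)).
      apply filterlim_C_plus; auto. apply filterlim_C_plus; auto.
      all: apply filterlim_C_const; auto.
Qed.

Lemma filterlim_rGamma {T} (F : (T -> Prop) -> Prop) {FF : Filter F} f (l : C) :
  filterlim f F (locally l) -> filterlim (fun x => rGamma (f x)) F (locally (rGamma l)).
Proof. intros H. apply filterlim_comp with (1 := H). apply rGamma_continuous. Qed.

(** The constant is the product of the values of the gamma factors at [s = 0],
    where the singular factor [Gamma (- s)] is replaced by its residue; at [s = k]
    each of them is multiplied, up to sign, by a Pochhammer symbol or its inverse. *)
Lemma pFq_residues (a1 a2 b : list C) :
  List.Forall (fun x => ~ nonpos_int x) a1 ->
  List.Forall nonpos_int a2 ->
  List.Forall (fun x => ~ nonpos_int x) b ->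
  exists c : C, c <> 0 /\
  forall k : nat,
    filterlim
      (fun s => (s - INR k) * mkernel (pFq_meijer a1 a2 b) s)
      (locally' (RtoC (INR k)))
      (locally (c * ((- (1)) ^ (S (length a2))) ^ k
                * pFq_coef (a1 ++ a2) b k)).
Proof.
rewrite !Forall_forall. intros H1 H2 H3.
assert (H2' : forall x, In x a2 -> ~ nonpos_int (1 - x)).
{ intros x Hx [j E]. destruct (H2 x Hx) as [i ->].
  apply (f_equal Re) in E. simpl in E. generalize (pos_INR i) (pos_INR j). lra. }
exists (- / rGamma 1 * Cprod (map (fun x => / rGamma x) a1) * Cprod (map rGamma b)
   * Cprod (map (fun x => rGamma (1 - x)) a2)).
split.
{ repeat apply Cmult_neq_0.
  - intros E. apply (Cinv_neq_0 (rGamma 1)). apply rGamma_neq_0, nonpos_int_1.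
    replace (/ rGamma 1) with (- - / rGamma 1) by ring. rewrite E. apply Copp_0.
  - apply Cprod_neq_0. intros. apply Cinv_neq_0, rGamma_neq_0; auto.
  - apply Cprod_neq_0. intros. apply rGamma_neq_0; auto.
  - apply Cprod_neq_0. intros. apply rGamma_neq_0; auto. }
intros k.
apply filterlim_ext with (fun s => ((s - INR k) * Gamma (0 - s))
   * (Cprod (map (fun x => / rGamma (x + s)) a1) * Cprod (map (fun x => rGamma (x + s)) b)
   * Cprod (map (fun x => rGamma (1 - x - s)) a2))).
{ intros s. unfold mkernel, pFq_meijer. cbn [mbnum manum mbden maden map].
  rewrite Cprod_cons, Cprod_nil, !map_map. unfold Cdiv. rewrite Cinv_mult_total.
  rewrite <- !Cprod_map_inv.
  rewrite (map_ext (fun x => / Gamma (1 - x - s)) (fun x => rGamma (1 - x - s))).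
  2:{ intros. now rewrite Gamma_rGamma, Cinv_inv_total. }
  rewrite (map_ext (fun x => / Gamma (1 - (1 - x) + s)) (fun x => rGamma (x + s))).
  2:{ intros. rewrite Gamma_rGamma, Cinv_inv_total. f_equal; ring. }
  rewrite (map_ext (fun x => Gamma (1 - (1 - x) + s)) (fun x => / rGamma (x + s))).
  2:{ intros. rewrite Gamma_rGamma. do 2 f_equal; ring. }
  ring. }
replace (_ * pFq_coef _ _ _) with ((- / rGamma 1 * (- (1)) ^ k / INR (fact k))
  * (Cprod (map (fun x => / rGamma (x + INR k)) a1)
      * Cprod (map (fun x => rGamma (x + INR k)) b)
   * Cprod (map (fun x => rGamma (1 - x - INR k)) a2))).
- assert (FF : Filter (locally' (RtoC (INR k)))) by apply locally'_filter.
  assert (Hid : filterlim (fun s : C => s) (locally' (RtoC (INR k)))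
    (locally (RtoC (INR k)))).
  { intros P HP. unfold filtermap, locally', within. revert HP. apply filter_imp. auto. }
  apply filterlim_C_mult; auto. apply Gamma_residue.
  repeat apply filterlim_C_mult; auto.
  + apply (filterlim_Cprod _ (fun x s => / rGamma (x + s)) (fun x => / rGamma (x + INR k))).
    intros x Hx. apply filterlim_C_inv; auto. apply rGamma_neq_0, shifted_not_nonpos_int;
      auto.
    apply filterlim_rGamma; auto. apply filterlim_C_plus; auto.
    apply filterlim_C_const; auto.
  + apply (filterlim_Cprod _ (fun x s => rGamma (x + s)) (fun x => rGamma (x + INR k))).
    intros x Hx.
    apply filterlim_rGamma; auto. apply filterlim_C_plus; auto.
    apply filterlim_C_const; auto.
  + apply (filterlim_Cprod _ (fun x s => rGamma (1 - x - s)) (fun x =>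
      rGamma (1 - x - INR k))).
    intros x Hx.
    apply filterlim_rGamma; auto. apply filterlim_C_minus; auto.
    apply filterlim_C_const; auto.
- unfold pFq_coef. rewrite map_app, Cprod_app.
  rewrite (map_ext_in (fun x => / rGamma (x + INR k)) (fun x =>
    / rGamma x * pochhammer x k) a1).
  2:{ intros x Hx. rewrite (rGamma_pochhammer x k).
      assert (rGamma (x + INR k) <> 0) by (apply rGamma_neq_0, shifted_not_nonpos_int;
        auto).
      assert (pochhammer x k <> 0) by (apply pochhammer_neq_0; auto). field; auto. }
  rewrite (map_ext_in (fun x => rGamma (x + INR k)) (fun x =>
    rGamma x * / pochhammer x k) b).
  2:{ intros x Hx. rewrite (rGamma_pochhammer x k).
      assert (pochhammer x k <> 0) by (apply pochhammer_neq_0; auto). field; auto. }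
  rewrite (map_ext_in (fun x => rGamma (1 - x - INR k)) (fun x =>
    rGamma (1 - x) * ((- (1)) ^ k * pochhammer x k)) a2).
  2:{ intros x Hx. rewrite (rGamma_pochhammer (1 - x - INR k) k), pochhammer_reflect.
      replace (1 - x - INR k + INR k) with (1 - x) by ring. ring. }
  rewrite !Cprod_map_mult, Cprod_const, Cprod_map_inv,
    (Cprod_map_inv (fun x => pochhammer x k)).
  replace (((- (1)) ^ S (length a2)) ^ k) with ((- (1)) ^ k * ((- (1)) ^ k) ^ length a2).
  2:{ rewrite <- !Cpow_mult_r, <- Cpow_add_r. f_equal. lia. }
  unfold Cdiv. rewrite Cinv_mult_total.
  generalize ((- (1)) ^ k). intros e. generalize (e ^ length a2). intros e'. ring.
Qed.

(** * Convergence and zeros of the double gamma product *)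

Lemma Cprod_filter {A} (P : A -> bool) (f : A -> C) l :
  Cprod (map f (filter P l)) = Cprod (map (fun x => if P x then f x else 1) l).
Proof.
induction l as [|a l IH]; simpl. reflexivity.
destruct (P a); simpl; rewrite IH; ring.
Qed.

Lemma Cprod_list_prod {A B} (f : A * B -> C) l1 l2 :
  Cprod (map f (list_prod l1 l2))
    = Cprod (map (fun a => Cprod (map (fun b => f (a, b)) l2)) l1).
Proof.
induction l1 as [|a l IH]; simpl. reflexivity.
now rewrite map_app, Cprod_app, IH, map_map.
Qed.

Lemma Cprod_exchange {A B} (f : A -> B -> C) l1 l2 :
  Cprod (map (fun a => Cprod (map (fun b => f a b) l2)) l1)
  = Cprod (map (fun b => Cprod (map (fun a => f a b) l1)) l2).
Proof.
induction l1 as [|a l IH]; simpl.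
- induction l2; simpl; auto. rewrite <- IHl2; ring.
- now rewrite Cprod_map_mult, IH.
Qed.

Lemma Cprod_near_1 {A} (f : A -> C) (d : R) l :
  (forall x, In x l -> (Cmod (f x - 1) <= d)%R) -> (0 <= d)%R ->
    (2 * (INR (length l) * d) <= 1)%R ->
  (Cmod (Cprod (map f l) - 1) <= 2 * (INR (length l) * d))%R.
Proof.
intros H Hd. induction l as [|a l IH]; intros Hl.
- simpl. replace (1 - 1) with (RtoC 0) by ring. rewrite Cmod_0. lra.
- cbn [map length]. rewrite Cprod_cons. cbn [length] in Hl. rewrite S_INR in *.
  assert (IH' : (Cmod (Cprod (map f l) - 1) <= 2 * (INR (length l) * d))%R).
  { apply IH; [|lra]. intros; apply H; now right. }
  assert (Ha := H a (or_introl eq_refl)).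
  set (P := Cprod (map f l)) in *.
  replace (f a * P - 1) with ((P - 1) + P * (f a - 1)) by ring.
  eapply Rle_trans; [apply Cmod_triangle|]. rewrite Cmod_mult.
  assert (HP : (Cmod P <= 2)%R).
  { replace P with ((P - 1) + 1) by ring. eapply Rle_trans; [apply Cmod_triangle|].
    rewrite Cmod_1.
    lra. }
  assert (Cmod P * Cmod (f a - 1) <= 2 * d)%R.
  { apply Rmult_le_compat; auto using Cmod_ge_0. }
  lra.
Qed.

(** The pairs [(k, l)] with [max (k, l) = n + 1]. *)
Definition shell (n : nat) : list (nat * nat) :=
  map (fun k => (k, S n)) (seq 0 (S n)) ++ map (fun l => (S n, l)) (seq 0 (S (S n))).

Definition shell_factor (tau : R) (n : nat) (z : C) : C :=
  Cprod (map (dg_factor tau z) (shell n)).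

Lemma dg_partial_S tau n z : dg_partial tau (S n) z
  = dg_partial tau n z * shell_factor tau n z.
Proof.
unfold dg_partial, dg_index, shell_factor, shell.
rewrite !Cprod_filter, !Cprod_list_prod, map_app, Cprod_app, !map_map.
set (F := fun kl : nat * nat =>
  if negb (fst kl + snd kl =? 0)%nat then dg_factor tau z kl else 1).
change (Cprod (map (fun a => Cprod (map (fun b => F (a, b)) (seq 0 (S (S n)))))
  (seq 0 (S (S n)))) =
 Cprod (map (fun a => Cprod (map (fun b => F (a, b)) (seq 0 (S n)))) (seq 0 (S n))) *
 (Cprod (map (fun k => dg_factor tau z (k, S n)) (seq 0 (S n)))
   * Cprod (map (fun l => dg_factor tau z (S n, l)) (seq 0 (S (S n)))))).
rewrite (map_ext (fun k => dg_factor tau z (k, S n)) (fun k => F (k, S n))).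
2:{ intros k. unfold F. cbn [fst snd]. replace (k + S n)%nat with (S (k + n)) by lia.
  reflexivity. }
rewrite (map_ext (fun l => dg_factor tau z (S n, l)) (fun l => F (S n, l))).
2:{ intros k. reflexivity. }
assert (HS : forall h : nat -> C, Cprod (map h (seq 0 (S (S n))))
  = Cprod (map h (seq 0 (S n))) * h (S n)).
{ intros h. rewrite (seq_S (S n) 0), map_app, Cprod_app. cbn [map].
  rewrite Cprod_cons, Cprod_nil.
  replace (0 + S n)%nat with (S n) by lia. ring. }
rewrite (HS (fun a => Cprod (map (fun b => F (a, b)) (seq 0 (S (S n)))))).
rewrite (map_ext (fun a => Cprod (map (fun b => F (a, b)) (seq 0 (S (S n)))))
  (fun a => Cprod (map (fun b => F (a, b)) (seq 0 (S n))) * F (a, S n)))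
    by (intros k; apply HS).
rewrite Cprod_map_mult. ring.
Qed.

Lemma shell_length n : length (shell n) = (2 * n + 3)%nat.
Proof. unfold shell. rewrite length_app, !length_map, !length_seq. lia. Qed.

(** The lattice points of the [n]-th shell have size at least
    [min (tau, 1) (n + 1)]. *)
Lemma shell_lower_bound tau n k l : (0 < tau)%R -> In (k, l) (shell n) ->
  (Rmin tau 1 * INR (S n) <= INR k * tau + INR l)%R.
Proof.
intros Ht H. unfold shell in H.
generalize (Rmin_l tau 1) (Rmin_r tau 1) (pos_INR k) (pos_INR l) (pos_INR (S n)). intros.
assert (0 < Rmin tau 1)%R by (apply Rmin_glb_lt; lra).
apply in_app_or in H. destruct H as [H|H]; apply in_map_iff in H; destruct H as (x & E & _);
  injection E as <- <-; nra.
Qed.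

Lemma dg_factor_near_1 tau z k l (r : R) : (0 < INR k * tau + INR l)%R ->
  (Cmod z <= r)%R -> (r <= INR k * tau + INR l)%R ->
  (Cmod (dg_factor tau z (k, l) - 1) <= 2 * exp 2 * (r / (INR k * tau + INR l)) ^ 3)%R.
Proof.
intros Hw Hz Hr. unfold dg_factor. cbn [fst snd].
set (w := (INR k * tau + INR l)%R) in *.
assert (Hw' : RtoC w <> 0) by (apply RtoC_neq; lra).
replace (- (z / w) + z ^ 2 / (2 * w ^ 2)) with (- (z / w) + (z / w) ^ 2 / 2).
2:{ field. auto. }
assert (Hm : (Cmod (z / w) <= r / w)%R).
{ rewrite Cmod_div, Cmod_R, Rabs_pos_eq by (auto; lra). apply Rmult_le_compat_r; auto.
  left; now apply Rinv_0_lt_compat. }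
eapply Rle_trans. apply weierstrass_factor_bound.
- eapply Rle_trans; [exact Hm|]. apply Rmult_le_reg_r with w; auto.
  unfold Rdiv; rewrite Rmult_assoc, Rinv_l; lra.
- apply Rmult_le_compat_l. generalize (exp_pos 2); lra. apply pow_incr.
  split; auto using Cmod_ge_0.
Qed.

Lemma shell_factor_near_1 tau : (0 < tau)%R -> forall r : R, exists (K : R) (N : nat),
  forall n s, (N <= n)%nat -> (Cmod s <= r)%R ->
  (Cmod (shell_factor tau n s - 1) <= K / (INR (S n) * INR (S (S n))))%R.
Proof.
intros Ht r.
set (mu := Rmin tau 1).
assert (Hmu : (0 < mu)%R) by (apply Rmin_glb_lt; lra).
set (r' := Rmax r 0).
assert (Hr0 : (0 <= r')%R) by apply Rmax_r.
(* Each of the [2 n + 3] factors is [1 + O(c / (n + 1)^3)]. *)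
set (c := (2 * exp 2 * (r' / mu) ^ 3)%R).
assert (Hrm : (0 <= r' / mu)%R).
{ apply Rmult_le_pos; auto. left; now apply Rinv_0_lt_compat. }
assert (Hc : (0 <= c)%R).
{ unfold c. apply Rmult_le_pos. generalize (exp_pos 2); lra. now apply pow_le. }
destruct (nfloor_ex (r' / mu + 6 * c)%R) as [N HN]; [lra|].
exists (12 * c)%R, N. intros n s Hn Hs.
set (x := INR (S n)).
assert (Hx : (r' / mu + 6 * c <= x)%R).
{ apply Rle_trans with (INR (S N)). rewrite S_INR; lra. apply le_INR; lia. }
assert (Hx1 : (1 <= x)%R) by (unfold x; rewrite S_INR; generalize (pos_INR n); lra).
assert (HL : (INR (length (shell n)) <= 3 * x)%R).
{ rewrite shell_length. unfold x. rewrite S_INR.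
  replace (INR (2 * n + 3)) with (2 * INR n + 3)%R
    by (rewrite plus_INR, mult_INR; simpl; ring).
  generalize (pos_INR n). lra. }
set (d := (c / x ^ 3)%R).
assert (Hx3 : (0 < x ^ 3)%R) by (apply pow_lt; lra).
assert (Hd : (0 <= d)%R).
{ unfold d. apply Rmult_le_pos; auto. left; now apply Rinv_0_lt_compat. }
assert (HLd : (2 * (INR (length (shell n)) * d) <= 6 * c / x ^ 2)%R).
{ apply Rle_trans with (2 * (3 * x * d))%R. apply Rmult_le_compat_l. lra.
  now apply Rmult_le_compat_r.
  unfold d. right. field. lra. }
assert (Hx2 : (0 < x ^ 2)%R) by (apply pow_lt; lra).
eapply Rle_trans. apply (Cprod_near_1 _ d).
- intros [k l] Hkl. generalize (shell_lower_bound tau n k l Ht Hkl). fold mu. fold x.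
  intros Hw.
  set (w := (INR k * tau + INR l)%R) in *.
  assert (Hrw : (r' <= mu * x)%R).
  { apply Rle_trans with (mu * (r' / mu))%R. right; field; lra.
    apply Rmult_le_compat_l; lra. }
  assert (Hmx : (0 < mu * x)%R) by (apply Rmult_lt_0_compat; lra).
  eapply Rle_trans. apply (dg_factor_near_1 tau s k l r'); fold w; try lra.
  { eapply Rle_trans; [exact Hs|apply Rmax_l]. }
  fold w. unfold d, c.
  replace (2 * exp 2 * (r' / mu) ^ 3 / x ^ 3)%R with (2 * exp 2 * (r' / (mu * x)) ^ 3)%R
    by (field; lra).
  apply Rmult_le_compat_l. generalize (exp_pos 2); lra. apply pow_incr. split.
  + apply Rmult_le_pos; auto. left; apply Rinv_0_lt_compat; lra.
  + apply Rmult_le_compat_l; auto. apply Rinv_le_contravar; lra.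
- auto.
- eapply Rle_trans; [exact HLd|]. apply Rmult_le_reg_r with (x ^ 2)%R; auto.
  unfold Rdiv; rewrite Rmult_assoc, Rinv_l by lra. nra.
- eapply Rle_trans; [exact HLd|].
  rewrite S_INR. fold x.
  apply Rmult_le_reg_r with (x ^ 2 * (x + 1))%R. apply Rmult_lt_0_compat; lra.
  replace (6 * c / x ^ 2 * (x ^ 2 * (x + 1)))%R with (6 * c * (x + 1))%R by (field; lra).
  replace (12 * c / (x * (x + 1)) * (x ^ 2 * (x + 1)))%R with (12 * c * x)%R
    by (field; lra).
  nra.
Qed.

(** The zero set of [G(. ; tau)]. *)
Definition lattice (tau : R) (z : C) : Prop :=
  exists k l : nat, z = - RtoC (INR k * tau + INR l)%R.

(** The infinite product of [G(. ; tau)], without its elementary prefactor. *)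
Definition dg_product (tau : R) (z : C) : C := Clim (fun n => dg_partial tau n z).

Lemma dg_product_neq_0 tau z : (0 < tau)%R -> ~ lattice tau z -> dg_product tau z <> 0.
Proof.
intros Ht Hz.
apply (product_limit_neq_0 (shell_factor tau) (dg_partial tau) (dg_partial_S tau)
  (shell_factor_near_1 tau Ht)).
intros n. apply Cprod_neq_0. intros [k l] Hkl. apply filter_In in Hkl.
destruct Hkl as [_ Hkl].
cbn [fst snd] in Hkl. unfold dg_factor. cbn [fst snd].
apply Cmult_neq_0; [|apply Cexp_neq_0].
set (w := (INR k * tau + INR l)%R).
assert (Hw : (0 < w)%R).
{ unfold w. destruct (Nat.eqb_spec (k + l) 0) as [E|E]; [discriminate|].
  generalize (pos_INR k) (pos_INR l); intros.
  destruct k as [|k].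
  - assert (0 < INR l)%R by (apply lt_0_INR; lia). nra.
  - assert (0 < INR (S k))%R by (apply lt_0_INR; lia). nra. }
intros E. apply Hz. exists k, l. fold w.
assert (Hw' : RtoC w <> 0) by (apply RtoC_neq; lra).
replace z with (w * (1 + z / w) - w) by (field; auto). rewrite E. ring.
Qed.

(** With parameters [1 / tau] and [z / tau], the factor of index [(k, l)] is the
    factor of index [(l, k)] for [tau] and [z]. *)
Lemma dg_partial_modular tau n z : tau <> 0%R ->
  dg_partial (/ tau) n (z / tau) = dg_partial tau n z.
Proof.
intros Ht. unfold dg_partial, dg_index.
rewrite !Cprod_filter, !Cprod_list_prod, Cprod_exchange.
f_equal. apply map_ext. intros l. f_equal. apply map_ext. intros k.
cbn [fst snd]. rewrite (Nat.add_comm l k). destruct (negb _); auto.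
unfold dg_factor. cbn [fst snd].
assert (Ht' : RtoC tau <> 0) by now apply RtoC_neq.
replace (INR k * / tau + INR l)%R with (/ tau * (INR l * tau + INR k))%R by (field; auto).
set (w := (INR l * tau + INR k)%R). rewrite RtoC_mult, RtoC_inv by auto.
replace (z / tau / (/ tau * w)) with (z / w).
2:{ unfold Cdiv. rewrite !Cinv_mult_total, Cinv_inv_total.
    transitivity (z * (/ tau * tau) * / w); [rewrite Cinv_l by auto|]; ring. }
replace ((z / tau) ^ 2 / (2 * (/ tau * w) ^ 2)) with (z ^ 2 / (2 * w ^ 2)); auto.
unfold Cdiv. rewrite !Cpow_mult_l, !Cinv_mult_total, !Cpow_inv, Cinv_inv_total by auto.
assert (tau ^ 2 <> 0) by now apply Cpow_nz.
transitivity (z ^ 2 * (/ tau ^ 2 * tau ^ 2) * (/ 2 * / w ^ 2)); [rewrite Cinv_l by auto|];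
  ring.
Qed.

Lemma dg_product_modular tau z : tau <> 0%R ->
  dg_product (/ tau) (z / tau) = dg_product tau z.
Proof.
intros Ht. unfold dg_product, Clim. f_equal; f_equal; apply Lim_seq_ext; intros n;
  now rewrite dg_partial_modular.
Qed.

(** [g] has the product form of [G(. ; tau)] with the constants [c1], [c2]. *)
Definition dg_form (tau : R) (g : C -> C) (c1 c2 : R) : Prop := forall z,
  g z = z / tau * Cexp (c1 * z / tau + c2 * z ^ 2 / (2 * tau ^ 2)) * dg_product tau z.

Lemma double_gamma_form tau g : (0 < tau)%R -> is_double_gamma tau g -> exists c1 c2,
  dg_form tau g c1 c2.
Proof.
intros Ht (c1 & c2 & H & _). exists c1, c2. intros z.
eapply (filterlim_C_unique eventually). apply (H z).
apply filterlim_C_mult. apply eventually_filter. apply filterlim_C_const, eventually_filter.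
apply (product_converges (shell_factor tau) (dg_partial tau) (dg_partial_S tau)
  (shell_factor_near_1 tau Ht)).
Qed.

Lemma double_gamma_neq_0 tau g z : (0 < tau)%R -> is_double_gamma tau g ->
  ~ lattice tau z -> g z <> 0.
Proof.
intros Ht Hg Hz. destruct (double_gamma_form tau g Ht Hg) as (c1 & c2 & E). rewrite E.
apply Cmult_neq_0; [|now apply dg_product_neq_0].
apply Cmult_neq_0; [|apply Cexp_neq_0].
apply Cdiv_neq_0; [|apply RtoC_neq; lra].
intros ->. apply Hz. exists O, O. simpl. rewrite Rmult_0_l, Rplus_0_l. ring.
Qed.

(** * Properties holding off a locally finite set *)

(** [P] holds off a locally finite set.  By definition [mero_eq f g] is
    [generically (fun s => f s = g s)]. *)
Definition generically (P : C -> Prop) : Prop :=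
  exists E : C -> Prop, locally_finite E /\ forall s, ~ E s -> P s.

Lemma generically_imp (P Q : C -> Prop) : (forall s, P s -> Q s) -> generically P ->
  generically Q.
Proof. intros H (E & HE & HP). exists E; auto. Qed.

Lemma generically_all (P : C -> Prop) : (forall s, P s) -> generically P.
Proof. intros H. exists (fun _ => False). split; auto. intros r. exists []. tauto. Qed.

Lemma generically_and (P Q : C -> Prop) : generically P -> generically Q ->
  generically (fun s => P s /\ Q s).
Proof.
intros (E & HE & HP) (F & HF & HQ). exists (fun s => E s \/ F s). split.
- intros r. destruct (HE r) as [l1 H1], (HF r) as [l2 H2]. exists (l1 ++ l2).
  intros s [H|H] Hs; apply in_or_app; auto.
- intros s H. split; [apply HP|apply HQ]; tauto.
Qed.

Lemma generically_affine (P : C -> Prop) (a b : C) : a <> 0 -> generically P ->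
  generically (fun s => P (a * s + b)).
Proof.
intros Ha (E & HE & HP). exists (fun s => E (a * s + b)). split; auto.
intros r. destruct (HE (Cmod a * Rmax r 0 + Cmod b)%R) as [l Hl].
exists (map (fun z => (z - b) / a) l). intros s Hs Hr.
apply in_map_iff. exists (a * s + b). split. field; auto.
apply Hl; auto. eapply Rle_trans; [apply Cmod_triangle|]. rewrite Cmod_mult.
apply Rplus_le_compat_r, Rmult_le_compat_l; [apply Cmod_ge_0|].
eapply Rle_trans; [exact Hr|apply Rmax_l].
Qed.

Lemma generically_plus (P : C -> Prop) (b : C) : generically P ->
  generically (fun s => P (s + b)).
Proof.
intros H. apply generically_imp with (2 := generically_affine P 1 b C1_nz H).
intros s. now rewrite Cmult_1_l.
Qed.

Lemma Cm1_neq_0 : - (1) <> RtoC 0.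
Proof. intros E. apply (f_equal Re) in E. simpl in E. lra. Qed.

Lemma generically_minus (P : C -> Prop) (b : C) : generically P ->
  generically (fun s => P (b - s)).
Proof.
intros H. apply generically_imp with (2 := generically_affine P (- (1)) b Cm1_neq_0 H).
intros s. now replace (- (1) * s + b) with (b - s) by ring.
Qed.

Lemma generically_Forall {A} (P : A -> C -> Prop) l :
  (forall a, In a l -> generically (P a)) ->
    generically (fun s => List.Forall (fun a => P a s) l).
Proof.
induction l as [|a l IH]; intros H.
- apply generically_all; auto.
- apply generically_imp with (fun s => P a s /\ List.Forall (fun a => P a s) l).
  + intros s []; now constructor.
  + apply generically_and. apply H; now left. apply IH; intros; apply H; now right.
Qed.

(** * Functional equations of the double gamma function *)

Lemma lattice_locally_finite tau : (0 < tau)%R -> locally_finite (lattice tau).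
Proof.
intros Ht r.
destruct (nfloor_ex (Rmax r 0 / tau)%R) as [N HN].
{ apply Rmult_le_pos. apply Rmax_r. left; now apply Rinv_0_lt_compat. }
destruct (nfloor_ex (Rmax r 0)%R) as [M HM]; [apply Rmax_r|].
exists (map (fun kl => - RtoC (INR (fst kl) * tau + INR (snd kl))%R)
  (list_prod (seq 0 (S N)) (seq 0 (S M)))).
intros s (k & l & ->) Hs. apply in_map_iff. exists (k, l). split; auto.
rewrite Cmod_opp, Cmod_R in Hs.
generalize (pos_INR k) (pos_INR l); intros Hk Hl.
rewrite Rabs_pos_eq in Hs by nra.
assert (Hr : (INR k * tau + INR l <= Rmax r 0)%R)
  by (eapply Rle_trans; [exact Hs|apply Rmax_l]).
apply in_prod; apply in_seq.
- assert (k < S N)%nat; [|lia]. apply INR_lt. rewrite S_INR.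
  apply Rle_lt_trans with (Rmax r 0 / tau)%R; [|lra].
  apply Rmult_le_reg_r with tau; auto. unfold Rdiv; rewrite Rmult_assoc, Rinv_l by lra. lra.
- assert (l < S M)%nat; [|lia]. apply INR_lt. rewrite S_INR. nra.
Qed.

Lemma dg_product_lattice tau k l : (0 < tau)%R -> (0 < k + l)%nat ->
  dg_product tau (- RtoC (INR k * tau + INR l)%R) = 0.
Proof.
intros Ht Hkl. unfold dg_product. apply Clim_unique.
apply filterlim_ext_loc with (fun _ => RtoC 0); [|apply filterlim_const].
exists (k + l)%nat. intros n Hn. unfold dg_partial.
destruct (in_split (k, l) (dg_index n)) as (l1 & l2 & E).
{ unfold dg_index. apply filter_In. split. apply in_prod; apply in_seq; lia.
  cbn [fst snd]. destruct (Nat.eqb_spec (k + l) 0); auto; lia. }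
rewrite E, map_app, Cprod_app. cbn [map]. rewrite Cprod_cons.
unfold dg_factor at 2. cbn [fst snd].
set (w := (INR k * tau + INR l)%R).
assert (Hw : (0 < w)%R).
{ unfold w. generalize (pos_INR k) (pos_INR l); intros.
  destruct k as [|k].
  - assert (0 < INR l)%R by (apply lt_0_INR; lia). nra.
  - assert (0 < INR (S k))%R by (apply lt_0_INR; lia). nra. }
replace (1 + - RtoC w / w) with (RtoC 0). ring. field. apply RtoC_neq; lra.
Qed.

Section DoubleGamma.
Context (G : R -> C -> C) (HG : forall tau : R, (0 < tau)%R -> is_double_gamma tau (G tau)).

Lemma double_gamma_zeros tau z : (0 < tau)%R -> (G tau z = 0 <-> lattice tau z).
Proof.
intros Ht. split.
- intros E. destruct (Classical_Prop.classic (lattice tau z)) as [H|H]; auto.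
  exfalso. now apply (double_gamma_neq_0 tau (G tau) z Ht (HG tau Ht) H).
- intros (k & l & ->). destruct (double_gamma_form tau (G tau) Ht (HG tau Ht)) as
    (c1 & c2 & E).
  rewrite E. destruct (Nat.eq_dec (k + l) 0) as [Hkl|Hkl].
  + assert (k = 0%nat) as -> by lia. assert (l = 0%nat) as -> by lia. simpl.
    rewrite Rmult_0_l, Rplus_0_l, Copp_0. unfold Cdiv. ring.
  + rewrite dg_product_lattice by (auto; lia). ring.
Qed.

Lemma generically_G_neq_0 tau : (0 < tau)%R -> generically (fun z => G tau z <> 0).
Proof.
intros Ht. exists (lattice tau). split. now apply lattice_locally_finite.
intros s Hs E. apply Hs. now apply double_gamma_zeros.
Qed.

Lemma nonpos_int_lattice tau z : nonpos_int z -> lattice tau z.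
Proof. intros [k ->]. exists O, k. simpl. now rewrite Rmult_0_l, Rplus_0_l. Qed.

Lemma nonpos_int_div_lattice tau z : (0 < tau)%R -> nonpos_int (z / tau) -> lattice tau z.
Proof.
intros Ht [k E]. exists k, O. simpl. rewrite Rplus_0_r, RtoC_mult.
assert (RtoC tau <> 0) by (apply RtoC_neq; lra).
replace z with (z / tau * tau) by (field; auto). rewrite E. ring.
Qed.

(** The elementary factor of the embedding formula,
    [(2 pi)^((1 - tau)/2) tau^(z - 1/2)], is [Cexp (embed_exponent tau z)]. *)
Definition embed_exponent (tau : R) (z : C) : C :=
  RtoC ((1 - tau) / 2 * ln (2 * PI))%R + (z - 1 / 2) * ln tau.

Lemma G_shift_1 tau z : (0 < tau)%R -> G tau z <> 0 ->
  G tau (z + 1) = Gamma (z / tau) * G tau z.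
Proof.
intros Ht Hz. destruct (HG tau Ht) as (c1 & c2 & _ & H & _). apply H.
intros Hn. apply Hz. apply double_gamma_zeros; auto. now apply nonpos_int_div_lattice.
Qed.

Lemma G_neq_0_nonpos_int tau z : (0 < tau)%R -> G tau z <> 0 -> ~ nonpos_int z.
Proof.
intros Ht Hz Hn. apply Hz. apply double_gamma_zeros; auto. now apply nonpos_int_lattice.
Qed.

(** The embedding formula holds wherever [G(z; tau) <> 0]. *)
Lemma Gamma_embed tau z : (0 < tau)%R -> G tau z <> 0 ->
  Gamma z = Cexp (embed_exponent tau z) * (G tau (z + tau) / G tau z).
Proof.
intros Ht Hz. destruct (HG tau Ht) as (c1 & c2 & _ & _ & H).
rewrite H by now apply G_neq_0_nonpos_int with tau.
unfold Rpower, embed_exponent. rewrite <- Cexp_RtoC.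
assert (E : Cexp (((1 - tau) / 2 * ln (2 * PI))%R + (z - 1 / 2) * ln tau) *
  Cexp ((tau - 1) / 2 * ln (2 * PI))%R * Cexp ((1 / 2 - z) * ln tau) = 1).
{ rewrite <- !Cexp_plus. transitivity (Cexp 0); [f_equal|apply Cexp_0].
  replace ((1 - tau) / 2 * ln (2 * PI))%R with (- ((tau - 1) / 2 * ln (2 * PI)))%R by field.
  rewrite RtoC_opp. ring. }
match type of E with ?X = _ => transitivity (X * Gamma z * (G tau z * / G tau z)) end.
- rewrite E, Cinv_r by auto. ring.
- unfold Cdiv. ring.
Qed.

Lemma Gamma_embed_formula tau : (0 < tau)%R ->
  mero_eq Gamma
       (fun s => RtoC (Rpower (2 * PI) ((1 - tau) / 2))
                 * Cexp ((s - 1 / 2) * ln tau) * (G tau (s + tau) / G tau s)).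
Proof.
intros Ht. apply generically_imp with (2 := generically_G_neq_0 tau Ht).
intros s Hs. rewrite (Gamma_embed tau s Ht Hs). unfold embed_exponent, Rpower.
now rewrite Cexp_plus, Cexp_RtoC.
Qed.

Lemma Gamma_embed_generically tau : (0 < tau)%R -> generically (fun z =>
  Gamma z = Cexp (embed_exponent tau z) * (G tau (z + tau) / G tau z)).
Proof.
intros Ht. apply generically_imp with (2 := generically_G_neq_0 tau Ht).
intros s Hs. now apply Gamma_embed.
Qed.

Lemma G_pos_neq_0 tau (x : R) : (0 < tau)%R -> (0 < x)%R -> G tau x <> 0.
Proof.
intros Ht Hx E. apply double_gamma_zeros in E; auto. destruct E as (k & l & E).
rewrite <- RtoC_opp in E. apply RtoC_inj in E. generalize (pos_INR k) (pos_INR l). nra.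
Qed.

(** The constants [A0], [A1] are not needed explicitly: they only contribute a
    factor [C lambda^(-s)] to a kernel. *)
Lemma G_modular tau : (0 < tau)%R -> exists A0 A1 : C, forall z,
  G tau z = Cexp (A0 + A1 * z - RtoC (ln tau / (2 * tau))%R * z ^ 2)
    * G (/ tau)%R (z / tau).
Proof.
intros Ht. assert (Ht' : (0 < / tau)%R) by now apply Rinv_0_lt_compat.
assert (Hc : RtoC tau <> 0) by (apply RtoC_neq; lra).
destruct (double_gamma_form tau (G tau) Ht (HG tau Ht)) as (c1 & c2 & E).
destruct (double_gamma_form (/ tau) (G (/ tau)%R) Ht' (HG _ Ht')) as (d1 & d2 & E').
set (A := (c1 / tau - d1)%R). set (B := ((c2 / tau ^ 2 - d2) / 2)%R).
assert (EG : forall z, G tau z = Cexp (RtoC (- ln tau)%R + A * z + B * z ^ 2)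
  * G (/ tau)%R (z / tau)).
{ intros z. rewrite E, E', dg_product_modular by lra.
  rewrite !Cexp_plus, Cexp_RtoC, exp_Ropp, exp_ln by auto.
  rewrite !RtoC_inv by lra.
  replace (d1 * (z / tau) / / tau) with (d1 * z) by (field; auto).
  replace (d2 * (z / tau) ^ 2 / (2 * (/ tau) ^ 2)) with (d2 * z ^ 2 / 2) by (field; auto).
  replace (c1 * z / tau) with (A * z + d1 * z).
  2:{ unfold A. rewrite RtoC_minus, RtoC_div by lra. field; auto. }
  replace (c2 * z ^ 2 / (2 * tau ^ 2)) with (B * z ^ 2 + d2 * z ^ 2 / 2).
  2:{ unfold B. rewrite RtoC_div, RtoC_minus, RtoC_div,
      RtoC_pow by (try apply pow_nonzero; lra). field; auto. }
  rewrite !Cexp_plus. field. auto. }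
(* The shift of [z] by [1] for [tau] is the shift of [z / tau] by [1 / tau] for [1 / tau];
   both involve [Gamma (z / tau)], which cancels. *)
assert (HB : forall x : R, (0 < x)%R ->
  (A + B * (2 * x + 1) + (/ tau - 1) / 2 * ln (2 * PI) + (1 / 2 - x / tau) * ln (/ tau)
    = 0)%R).
{ intros x Hx.
  assert (Hg : G tau x <> 0) by now apply G_pos_neq_0.
  assert (Hxt : (0 < x / tau)%R) by (apply Rmult_lt_0_compat; auto).
  assert (Hg' : G (/ tau)%R (x / tau)%R <> 0) by now apply G_pos_neq_0.
  assert (HGam : Gamma (x / tau)%R <> 0).
  { apply Gamma_neq_0. now apply G_neq_0_nonpos_int with (/ tau)%R. }
  assert (S1 := G_shift_1 tau x Ht Hg).
  destruct (HG _ Ht') as (? & ? & _ & _ & S2).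
  specialize (S2 (x / tau)%R (G_neq_0_nonpos_int _ _ Ht' Hg')).
  rewrite (EG (x + 1)), (EG x), <- RtoC_div in S1 by lra.
  replace ((x + 1) / tau) with (RtoC (x / tau)%R + RtoC (/ tau)%R) in S1.
  2:{ rewrite RtoC_div, RtoC_inv by lra. field; auto. }
  rewrite S2 in S1. unfold Rpower in S1. rewrite <- Cexp_RtoC in S1.
  set (g' := G (/ tau)%R (x / tau)%R) in *. set (gm := Gamma (x / tau)%R) in *.
  assert (S3 : Cexp (- ln tau + A * (x + 1) + B * (x + 1) ^ 2) *
     (Cexp ((/ tau - 1) / 2 * ln (2 * PI))%R * Cexp ((1 / 2 - (x / tau)%R) * ln (/ tau)))
     = Cexp (- ln tau + A * x + B * x ^ 2)).
  { assert (Hgg : gm * g' <> 0) by now apply Cmult_neq_0.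
    rewrite <- RtoC_opp.
    transitivity ((gm * (Cexp (RtoC (- ln tau)%R + A * x + B * x ^ 2) * g')) * / (gm * g')).
    - rewrite <- S1.
      match goal with |- ?a * (?b * ?c) = _ =>
        transitivity (a * (b * c) * ((gm * g') * / (gm * g'))) end.
      + rewrite Cinv_r by auto. ring.
      + ring.
    - match goal with |- _ = ?a => transitivity (a * ((gm * g') * / (gm * g'))) end.
      + ring.
      + rewrite Cinv_r by auto. ring. }
  rewrite <- !Cexp_plus in S3. apply (f_equal Cmod) in S3. rewrite !Cmod_Cexp in S3.
  apply exp_inv in S3. simpl in S3. unfold Rdiv in *.
  revert S3. generalize (ln tau) (ln (/ tau)) (ln (2 * PI)). intros a b c S3.
  ring_simplify in S3. ring_simplify. lra. }
(* Two values of [x] determine [B]. *)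
assert (B1 := HB 1%R Rlt_0_1). assert (B2 := HB 2%R ltac:(lra)).
exists (RtoC (- ln tau)%R), (RtoC A). intros z. rewrite EG. do 2 f_equal.
replace B with (- (ln tau / (2 * tau)))%R. rewrite !RtoC_opp. ring.
rewrite ln_Rinv in * by auto.
assert (BB : (2 * B = - (ln tau / tau))%R) by (unfold Rdiv in *; lra).
replace B with (2 * B / 2)%R by field. rewrite BB. field. lra.
Qed.

End DoubleGamma.

(** * Kernels and strata *)

Lemma Cinv_1 : / RtoC 1 = 1.
Proof. apply C_eq; unfold Re, Im; simpl; field. Qed.

(** Functions [C lambda^s] with a real choice of [ln lambda]. *)
Definition exp_affine (h : C -> C) : Prop := exists (U : C) (V : R), forall s,
  h s = Cexp (U + V * s).

Lemma exp_affine_mult h1 h2 : exp_affine h1 -> exp_affine h2 ->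
  exp_affine (fun s => h1 s * h2 s).
Proof.
intros (U1 & V1 & H1) (U2 & V2 & H2). exists (U1 + U2), (V1 + V2)%R. intros s.
rewrite H1, H2, <- Cexp_plus, RtoC_plus. f_equal. ring.
Qed.

Lemma exp_affine_inv h : exp_affine h -> exp_affine (fun s => / h s).
Proof.
intros (U & V & H). exists (- U), (- V)%R. intros s.
rewrite H, <- Cexp_opp, RtoC_opp. f_equal. ring.
Qed.

Lemma exp_affine_prod {A} (h : A -> C -> C) l : (forall a, exp_affine (h a)) ->
  exp_affine (fun s => Cprod (map (fun a => h a s) l)).
Proof.
intros H. induction l as [|a l IH].
- exists 0, 0%R. intros s. simpl. rewrite Cmult_0_l, Cplus_0_r, Cexp_0. reflexivity.
- simpl. now apply exp_affine_mult.
Qed.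

(** Exponentials of quadratic polynomials with leading coefficient [beta]; [beta]
    is additive under products. *)
Definition exp_quad (beta : C) (h : C -> C) : Prop :=
  exists U V : C, forall s, h s = Cexp (U + V * s + beta * s ^ 2).

Lemma exp_quad_mult b1 b2 h1 h2 : exp_quad b1 h1 -> exp_quad b2 h2 ->
  exp_quad (b1 + b2) (fun s => h1 s * h2 s).
Proof.
intros (U1 & V1 & H1) (U2 & V2 & H2). exists (U1 + U2), (V1 + V2). intros s.
rewrite H1, H2, <- Cexp_plus. f_equal. ring.
Qed.

Lemma exp_quad_inv b h : exp_quad b h -> exp_quad (- b) (fun s => / h s).
Proof.
intros (U & V & H). exists (- U), (- V). intros s. rewrite H, <- Cexp_opp. f_equal. ring.
Qed.

Lemma exp_quad_prod {A} b (h : A -> C -> C) l : (forall a, exp_quad b (h a)) ->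
  exp_quad (INR (length l) * b) (fun s => Cprod (map (fun a => h a s) l)).
Proof.
intros H. induction l as [|a l IH].
- exists 0, 0. intros s. simpl. transitivity (Cexp 0); [symmetry; apply Cexp_0|]. f_equal.
  ring.
- cbn [length map]. rewrite S_INR, RtoC_plus.
  replace ((INR (length l) + 1) * b) with (b + INR (length l) * b) by ring.
  now apply exp_quad_mult.
Qed.

(** In this section [G] is an arbitrary family of functions: the identities only
    rearrange products. *)
Section Kernels.
Context (G : R -> C -> C).

Lemma kkernel_blocks D s : kkernel G D s =
  Cprod (map (fun b => G (ktau D) (b - s)) (bnum D))
  * Cprod (map (fun a => G (ktau D) (1 + ktau D - a + s)) (anum D))
  / (Cprod (map (fun b => G (ktau D) (1 + ktau D - b + s)) (bden D))
     * Cprod (map (fun a => G (ktau D) (a - s)) (aden D)))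
  * Cexp (PI * kalpha D * s ^ 2 / ktau D).
Proof.
unfold kkernel, num_args, den_args. now rewrite !map_app, !Cprod_app, !map_map.
Qed.

Lemma kkernel_absorb_gm c D s :
  kkernel G (absorb_gm c D) s = G (ktau D) (c - s + ktau D) / G (ktau D) (c - s)
    * kkernel G D s.
Proof.
rewrite !kkernel_blocks. unfold absorb_gm; cbn [ktau kalpha bnum anum bden aden].
rewrite !map_app, !Cprod_app; cbn [map]; rewrite !Cprod_cons, !Cprod_nil.
replace (c + ktau D - s) with (c - s + ktau D) by ring.
unfold Cdiv. rewrite !Cinv_mult_total, Cinv_1. ring.
Qed.

Lemma kkernel_absorb_rgm c D s :
  kkernel G (absorb_rgm c D) s = / (G (ktau D) (c - s + ktau D) / G (ktau D) (c - s))
    * kkernel G D s.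
Proof.
rewrite !kkernel_blocks. unfold absorb_rgm; cbn [ktau kalpha bnum anum bden aden].
rewrite !map_app, !Cprod_app; cbn [map]; rewrite !Cprod_cons, !Cprod_nil.
replace (c + ktau D - s) with (c - s + ktau D) by ring.
unfold Cdiv. rewrite !Cinv_mult_total, Cinv_1, !Cinv_inv_total. ring.
Qed.

Lemma kkernel_absorb_gp c D s :
  kkernel G (absorb_gp c D) s = G (ktau D) (c + s + ktau D) / G (ktau D) (c + s)
    * kkernel G D s.
Proof.
rewrite !kkernel_blocks. unfold absorb_gp; cbn [ktau kalpha bnum anum bden aden].
rewrite !map_app, !Cprod_app; cbn [map]; rewrite !Cprod_cons, !Cprod_nil.
replace (1 + ktau D - (1 - c) + s) with (c + s + ktau D) by ring.
replace (1 + ktau D - (1 + ktau D - c) + s) with (c + s) by ring.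
unfold Cdiv. rewrite !Cinv_mult_total, Cinv_1. ring.
Qed.

Lemma kkernel_absorb_rgp c D s :
  kkernel G (absorb_rgp c D) s = / (G (ktau D) (c + s + ktau D) / G (ktau D) (c + s))
    * kkernel G D s.
Proof.
rewrite !kkernel_blocks. unfold absorb_rgp; cbn [ktau kalpha bnum anum bden aden].
rewrite !map_app, !Cprod_app; cbn [map]; rewrite !Cprod_cons, !Cprod_nil.
replace (1 + ktau D - (1 - c) + s) with (c + s + ktau D) by ring.
replace (1 + ktau D - (1 + ktau D - c) + s) with (c + s) by ring.
unfold Cdiv. rewrite !Cinv_mult_total, Cinv_1, !Cinv_inv_total. ring.
Qed.

Lemma kkernel_convolve D1 D2 s : ktau D1 = ktau D2 ->
  kkernel G (kconvolve D1 D2) s = kkernel G D1 s * kkernel G D2 s.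
Proof.
intros E. rewrite !kkernel_blocks. unfold kconvolve; cbn [ktau kalpha bnum anum bden aden].
rewrite !map_app, !Cprod_app, <- E.
replace (PI * (kalpha D1 + kalpha D2) * s ^ 2 / ktau D1) with
 (PI * kalpha D1 * s ^ 2 / ktau D1 + PI * kalpha D2 * s ^ 2 / ktau D1)
   by (unfold Cdiv; ring).
rewrite Cexp_plus. unfold Cdiv. rewrite !Cinv_mult_total. ring.
Qed.

Lemma Cprod_map_ext {A} (f g : A -> C) l : (forall a, f a = g a) ->
  Cprod (map f l) = Cprod (map g l).
Proof. intros H. f_equal. now apply map_ext. Qed.

Lemma kkernel_shift c D s :
  kkernel G D (s - c) =
  Cexp (PI * kalpha D * c ^ 2 / ktau D - 2 * PI * kalpha D * c / ktau D * s)
  * kkernel G (kshift c D) s.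
Proof.
rewrite !kkernel_blocks. unfold kshift; cbn [ktau kalpha bnum anum bden aden].
rewrite !map_map.
replace (PI * kalpha D * (s - c) ^ 2 / ktau D) with
  (PI * kalpha D * c ^ 2 / ktau D - 2 * PI * kalpha D * c / ktau D * s + PI * kalpha D
    * s ^ 2 / ktau D)
  by (unfold Cdiv; ring).
rewrite Cexp_plus.
rewrite (Cprod_map_ext (fun b => G (ktau D) (b - (s - c))) (fun b =>
  G (ktau D) (c + b - s))) by (intros; f_equal; ring).
rewrite (Cprod_map_ext (fun b => G (ktau D) (1 + ktau D - b + (s - c))) (fun b =>
  G (ktau D) (1 + ktau D - (c + b) + s))) by (intros; f_equal; ring).
rewrite (Cprod_map_ext (fun b => G (ktau D) (1 + ktau D - b + (s - c))) (fun b =>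
  G (ktau D) (1 + ktau D - (c + b) + s))) by (intros; f_equal; ring).
rewrite (Cprod_map_ext (fun b => G (ktau D) (b - (s - c))) (fun b =>
  G (ktau D) (c + b - s))) by (intros; f_equal; ring).
ring.
Qed.

Lemma kkernel_invert D s : kkernel G (kinvert D) s = kkernel G D (- s).
Proof.
rewrite !kkernel_blocks. unfold kinvert; cbn [ktau kalpha bnum anum bden aden].
rewrite !map_map.
replace ((- s) ^ 2) with (s ^ 2) by ring.
rewrite (Cprod_map_ext (fun b => G (ktau D) (b - - s)) (fun b =>
  G (ktau D) (1 + ktau D - (1 + ktau D - b) + s))) by (intros; f_equal; ring).
rewrite (Cprod_map_ext (fun b => G (ktau D) (b - - s)) (fun b =>
  G (ktau D) (1 + ktau D - (1 + ktau D - b) + s))) by (intros; f_equal; ring).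
unfold Cdiv, Cminus. rewrite !Cinv_mult_total. ring.
Qed.

(** [N] counts the parameters in the numerator minus those in the denominator. *)
Lemma stratum_blocks D : stratum D =
  (Z.of_nat (length (bnum D)) + Z.of_nat (length (anum D)) - Z.of_nat (length (bden D))
    - Z.of_nat (length (aden D)))%Z.
Proof. unfold stratum, km, kn, kp, kq. rewrite !length_app. lia. Qed.

Ltac stratum_tac := rewrite !stratum_blocks; cbn [ktau kalpha bnum anum bden aden];
  rewrite ?length_app, ?length_map; cbn [length]; lia.

Lemma stratum_absorb_gm c D : stratum (absorb_gm c D) = stratum D.
Proof. unfold absorb_gm; stratum_tac. Qed.
Lemma stratum_absorb_gp c D : stratum (absorb_gp c D) = stratum D.
Proof. unfold absorb_gp; stratum_tac. Qed.
Lemma stratum_absorb_rgm c D : stratum (absorb_rgm c D) = stratum D.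
Proof. unfold absorb_rgm; stratum_tac. Qed.
Lemma stratum_absorb_rgp c D : stratum (absorb_rgp c D) = stratum D.
Proof. unfold absorb_rgp; stratum_tac. Qed.
Lemma stratum_shift c D : stratum (kshift c D) = stratum D.
Proof. unfold kshift; stratum_tac. Qed.
Lemma stratum_invert D : stratum (kinvert D) = stratum D.
Proof. unfold kinvert; stratum_tac. Qed.
Lemma stratum_modular D : stratum (kmodular D) = stratum D.
Proof. unfold kmodular; stratum_tac. Qed.
Lemma stratum_convolve D1 D2 : stratum (kconvolve D1 D2) = (stratum D1 + stratum D2)%Z.
Proof. unfold kconvolve; stratum_tac. Qed.
Lemma stratum_embed tau M : stratum (kembed tau M) = 0%Z.
Proof. unfold kembed; stratum_tac. Qed.

Lemma stratum_op o D : stratum (op_data o D) = stratum D.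
Proof.
destruct o; simpl; rewrite ?stratum_shift, ?stratum_absorb_rgm, ?stratum_absorb_gm,
  ?stratum_absorb_rgp,
  ?stratum_absorb_gp, ?stratum_shift, ?stratum_invert, ?stratum_modular; reflexivity.
Qed.

End Kernels.

(** * Operations on represented kernels *)

Section Representation.
Context (G : R -> C -> C) (HG : forall tau : R, (0 < tau)%R -> is_double_gamma tau (G tau)).

Lemma represents_kernel D : represents G D (kkernel G D).
Proof.
exists 0, 0. apply generically_all. intros s. replace (0 - 0 * s) with (RtoC 0) by ring.
rewrite Cexp_0. ring.
Qed.

Lemma represents_mero_eq D phi psi : mero_eq phi psi -> represents G D phi ->
  represents G D psi.
Proof.
intros H (u & v & H'). exists u, v.
apply generically_imp with (2 := generically_and _ _ H H'). intros s []; congruence.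
Qed.

Lemma represents_scale D u v phi : represents G D phi ->
  represents G D (fun s => Cexp (u - v * s) * phi s).
Proof.
intros (u' & v' & H). exists (u + u'), (v + v'). apply generically_imp with (2 := H).
intros s ->. rewrite Cmult_assoc, <- Cexp_plus. do 2 f_equal. ring.
Qed.

Lemma represents_const D c phi : c <> RtoC 0 -> represents G D phi ->
  represents G D (fun s => c * phi s).
Proof.
intros Hc H. destruct (Cexp_surj c Hc) as [u <-].
generalize (represents_scale D u 0 phi H). apply represents_mero_eq.
apply generically_all. intros s. now replace (u - 0 * s) with u by ring.
Qed.

(** Common form of the absorption rules: [psi] carries the kernel of [D] to that of
    [D'], up to a factor [C lambda^(-s)]. *)
Lemma represents_factor D D' phi psi u v :
  generically (fun s => psi s * kkernel G D s = Cexp (u - v * s) * kkernel G D' s) ->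
  represents G D phi -> represents G D' (fun s => psi s * phi s).
Proof.
intros H (u' & v' & H'). exists (u + u'), (v + v').
apply generically_imp with (2 := generically_and _ _ H H'). intros s [E ->].
transitivity (Cexp (u' - v' * s) * (psi s * kkernel G D s)); [ring|].
rewrite E, Cmult_assoc, <- Cexp_plus. do 2 f_equal. ring.
Qed.

Lemma embed_exponent_plus tau c s : embed_exponent tau (c + s)
  = embed_exponent tau c + ln tau * s.
Proof. unfold embed_exponent. ring. Qed.

Lemma represents_absorb_gm c D phi : (0 < ktau D)%R -> represents G D phi ->
  represents G (absorb_gm c D) (fun s => Gamma (c - s) * phi s).
Proof.
intros Ht. apply represents_factor with (embed_exponent (ktau D) c) (RtoC (ln (ktau D))).
apply generically_imp with (2 := generically_minus _ c (Gamma_embed_generically G HG _ Ht)).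
intros s ->. rewrite kkernel_absorb_gm. unfold Cminus at 1. rewrite embed_exponent_plus.
replace (embed_exponent (ktau D) c + ln (ktau D) * - s)
  with (embed_exponent (ktau D) c - ln (ktau D) * s) by ring.
ring.
Qed.

Lemma represents_absorb_rgm c D phi : (0 < ktau D)%R -> represents G D phi ->
  represents G (absorb_rgm c D) (fun s => / Gamma (c - s) * phi s).
Proof.
intros Ht. apply represents_factor with (- embed_exponent (ktau D) c)
  (- RtoC (ln (ktau D))).
apply generically_imp with (2 := generically_minus _ c (Gamma_embed_generically G HG _ Ht)).
intros s ->. rewrite kkernel_absorb_rgm, Cinv_mult_total, <- Cexp_opp. unfold Cminus at 1.
rewrite embed_exponent_plus.
replace (- (embed_exponent (ktau D) c + ln (ktau D) * - s))
  with (- embed_exponent (ktau D) c - - ln (ktau D) * s) by ring.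
ring.
Qed.

Lemma represents_absorb_gp c D phi : (0 < ktau D)%R -> represents G D phi ->
  represents G (absorb_gp c D) (fun s => Gamma (c + s) * phi s).
Proof.
intros Ht. apply represents_factor with (embed_exponent (ktau D) c) (- RtoC (ln (ktau D))).
apply generically_imp with (2 := generically_plus _ c (Gamma_embed_generically G HG _ Ht)).
intros s E. rewrite (Cplus_comm s c) in E.
rewrite E, kkernel_absorb_gp, embed_exponent_plus.
replace (embed_exponent (ktau D) c + ln (ktau D) * s)
  with (embed_exponent (ktau D) c - - ln (ktau D) * s) by ring.
ring.
Qed.

Lemma represents_absorb_rgp c D phi : (0 < ktau D)%R -> represents G D phi ->
  represents G (absorb_rgp c D) (fun s => / Gamma (c + s) * phi s).
Proof.
intros Ht. apply represents_factor with (- embed_exponent (ktau D) c) (RtoC (ln (ktau D))).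
apply generically_imp with (2 := generically_plus _ c (Gamma_embed_generically G HG _ Ht)).
intros s E. rewrite (Cplus_comm s c) in E.
rewrite E, kkernel_absorb_rgp, Cinv_mult_total, <- Cexp_opp, embed_exponent_plus.
replace (- (embed_exponent (ktau D) c + ln (ktau D) * s))
  with (- embed_exponent (ktau D) c - ln (ktau D) * s) by ring.
ring.
Qed.

Lemma represents_shift c D phi : represents G D phi ->
  represents G (kshift c D) (fun s => phi (s - c)).
Proof.
intros (u & v & H).
exists (u + v * c + PI * kalpha D * c ^ 2 / ktau D), (v + 2 * PI * kalpha D * c / ktau D).
apply generically_imp with (2 := generically_plus _ (- c) H). intros s E.
change (s + - c) with (s - c) in E. rewrite E, kkernel_shift, Cmult_assoc, <- Cexp_plus.
do 2 f_equal. ring.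
Qed.

Lemma represents_invert D phi : represents G D phi ->
  represents G (kinvert D) (fun s => phi (- s)).
Proof.
intros (u & v & H). exists u, (- v).
apply generically_imp with (2 := generically_minus _ 0 H). intros s E.
replace (- s) with (0 - s) by ring. rewrite E, kkernel_invert.
replace (0 - s) with (- s) by ring. do 2 f_equal. ring.
Qed.

Lemma represents_convolve D1 D2 phi psi : ktau D1 = ktau D2 -> represents G D1 phi ->
  represents G D2 psi ->
  represents G (kconvolve D1 D2) (fun s => phi s * psi s).
Proof.
intros Et (u1 & v1 & H1) (u2 & v2 & H2). exists (u1 + u2), (v1 + v2).
apply generically_imp with (2 := generically_and _ _ H1 H2). intros s [-> ->].
rewrite kkernel_convolve by auto.
replace (u1 + u2 - (v1 + v2) * s) with (u1 - v1 * s + (u2 - v2 * s)) by ring.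
rewrite Cexp_plus. ring.
Qed.

(** The modular law for kernels. *)
Lemma kkernel_modular D : (0 < ktau D)%R ->
  exists u v : C, forall s, kkernel G D (ktau D * s)
    = Cexp (u - v * s) * kkernel G (kmodular D) s.
Proof.
intros Ht. destruct (G_modular G HG _ Ht) as (A0 & A1 & HM).
set (tau := ktau D) in *.
assert (Hc : RtoC tau <> 0) by (apply RtoC_neq; lra).
set (q := fun z : C => Cexp (A0 + A1 * z - RtoC (ln tau / (2 * tau))%R * z ^ 2)).
(* [beta] is the coefficient of [s^2] contributed by [G_modular] for an argument
   of the form [c - tau s] or [c + tau s]. *)
set (beta := RtoC (- (tau * ln tau / 2))%R).
assert (Hb : beta = - RtoC (ln tau / (2 * tau))%R * tau ^ 2).
{ unfold beta. rewrite <- RtoC_opp, <- RtoC_pow, <- RtoC_mult. f_equal. field. lra. }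
assert (Q1 : forall b, exp_quad beta (fun s => q (b - tau * s))).
{ intros b. exists (A0 + A1 * b - RtoC (ln tau / (2 * tau))%R * b ^ 2),
   (- (A1 * tau) + 2 * RtoC (ln tau / (2 * tau))%R * b * tau).
  intros s. unfold q. f_equal. rewrite Hb. ring. }
assert (Q2 : forall a, exp_quad beta (fun s => q (1 + tau - a + tau * s))).
{ intros a. exists (A0 + A1 * (1 + tau - a) - RtoC (ln tau / (2 * tau))%R
    * (1 + tau - a) ^ 2),
   (A1 * tau - 2 * RtoC (ln tau / (2 * tau))%R * (1 + tau - a) * tau).
  intros s. unfold q. f_equal. rewrite Hb. ring. }
assert (Q := exp_quad_mult _ _ _ _
  (exp_quad_mult _ _ _ _ (exp_quad_prod _ _ (bnum D) Q1) (exp_quad_prod _ _ (anum D) Q2))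
  (exp_quad_inv _ _ (exp_quad_mult _ _ _ _ (exp_quad_prod _ _ (bden D) Q2)
    (exp_quad_prod _ _ (aden D) Q1)))).
destruct Q as (U & V & Q). exists U, (- V). intros s. specialize (Q s). cbv beta in Q.
rewrite !kkernel_blocks. unfold kmodular; cbn [ktau kalpha bnum anum bden aden]. fold tau.
rewrite !map_map.
rewrite (Cprod_map_ext (fun b => G tau (b - tau * s)) (fun b =>
  q (b - tau * s) * G (/ tau)%R (b / tau - s))).
2:{ intros b. rewrite HM. unfold q. do 2 f_equal. field. auto. }
rewrite (Cprod_map_ext (fun b => G tau (b - tau * s)) (fun b =>
  q (b - tau * s) * G (/ tau)%R (b / tau - s))).
2:{ intros b. rewrite HM. unfold q. do 2 f_equal. field. auto. }
assert (Ha : forall a, G tau (1 + tau - a + tau * s)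
  = q (1 + tau - a + tau * s) * G (/ tau)%R (1 + (/ tau)%R - a / tau + s)).
{ intros a. rewrite HM. unfold q. do 2 f_equal. rewrite RtoC_inv by lra. field. auto. }
rewrite (Cprod_map_ext _ _ (anum D) Ha), (Cprod_map_ext _ _ (bden D) Ha).
rewrite !Cprod_map_mult.
(* The total contribution [N beta s^2] accounts for the change of [alpha]. *)
assert (EE : Cexp (PI * kalpha D * (tau * s) ^ 2 / tau)
  * Cexp (U + V * s + (INR (length (bnum D)) * beta + INR (length (anum D)) * beta +
     - (INR (length (bden D)) * beta + INR (length (aden D)) * beta)) * s ^ 2)
   = Cexp (U - - V * s) * Cexp (PI * (kalpha D - (IZR (stratum D) / (2 * PI) * ln tau)%R)
     * s ^ 2 / (/ tau)%R)).
{ rewrite <- !Cexp_plus. f_equal.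
  rewrite stratum_blocks, !minus_IZR, plus_IZR, <- !INR_IZR_INZ.
  rewrite RtoC_mult, RtoC_div by (generalize PI_RGT_0; lra).
  rewrite !RtoC_minus, RtoC_plus, RtoC_mult, RtoC_inv by lra. unfold beta.
  rewrite RtoC_opp, RtoC_div, RtoC_mult by lra.
  field. split; auto. apply RtoC_neq, PI_neq0. }
rewrite <- Q in EE.
unfold Cdiv in *. rewrite !Cinv_mult_total in *.
match goal with |- _ = _ * (?X * ?E) => transitivity (X * (Cexp (U - - V * s) * E));
  [|ring] end.
rewrite <- EE. ring.
Qed.

Lemma represents_modular D phi : (0 < ktau D)%R -> represents G D phi ->
  represents G (kmodular D) (fun s => ktau D * phi (ktau D * s)).
Proof.
intros Ht (u & v & H). apply represents_const. apply RtoC_neq; lra.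
destruct (kkernel_modular D Ht) as (u' & v' & HM).
exists (u + u'), (v * ktau D + v').
apply generically_imp with (2 :=
  generically_affine _ (ktau D) 0 (RtoC_neq _ _ (Rgt_not_eq _ _ Ht)) H).
intros s. rewrite Cplus_0_r. intros ->. rewrite HM, Cmult_assoc, <- Cexp_plus. do 2 f_equal.
ring.
Qed.

Lemma Gamma_pos_Re_neq_0 z : (0 < Re z)%R -> Gamma z <> 0.
Proof.
intros H. apply Gamma_neq_0. intros [k ->]. simpl in H. generalize (pos_INR k). lra.
Qed.

Lemma represents_op o D phi : (0 < ktau D)%R -> op_ok o -> represents G D phi ->
  represents G (op_data o D) (op_kernel o (ktau D) phi).
Proof.
intros Ht Ho H. destruct o; simpl op_data; simpl op_ok in Ho; unfold op_kernel.
- generalize (represents_absorb_rgm (gamma + delta + 1) (absorb_gm (gamma + 1) D) _ Ht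
    (represents_absorb_gm (gamma + 1) _ _ Ht H)).
  apply represents_mero_eq, generically_all. intros s. unfold Cdiv. ring.
- generalize (represents_shift (- delta) _ _
    (represents_absorb_rgm (delta + 1) (absorb_gm 1 D) _ Ht
    (represents_absorb_gm 1 _ _ Ht H))).
  apply represents_mero_eq, generically_all. intros s. cbv zeta.
  replace (s - - delta) with (s + delta) by ring. unfold Cdiv. ring.
- generalize (represents_const _ _ _ (Gamma_pos_Re_neq_0 _ Ho)
    (represents_absorb_rgm (beta + gamma) (absorb_gm beta D) _ Ht
    (represents_absorb_gm beta _ _ Ht H))).
  apply represents_mero_eq, generically_all. intros s. unfold Cdiv. ring.
- assert (Hk : (- (1)) ^ k <> 0) by (apply Cpow_nz, Cm1_neq_0).
  generalize (represents_const _ _ _ Hk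
    (represents_shift (INR k) _ _
    (represents_absorb_rgp 0 (absorb_gp (INR k) D) _ Ht
    (represents_absorb_gp (INR k) _ _ Ht H)))).
  apply represents_mero_eq, generically_all. intros s. cbv zeta.
  replace (0 + (s - INR k)) with (s - INR k) by ring.
  rewrite (Cplus_comm (INR k)). unfold Cdiv. generalize ((- (1)) ^ k). intros e. ring.
- assert (H' := represents_shift 1 _ _ (represents_invert _ _ H)).
  generalize (represents_absorb_gp 0 (kshift 1 (kinvert D)) _ Ht H').
  apply represents_mero_eq, generically_all. intros s.
  rewrite Cplus_0_l. do 2 f_equal. ring.
- now apply represents_shift.
- now apply represents_invert.
- now apply represents_modular.
Qed.

Lemma ktau_op o D : ktau (op_data o D) = op_tau o (ktau D).
Proof. destruct o; reflexivity. Qed.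

(** Gamma factor by gamma factor this is [Gamma_embed], which requires [G <> 0] at
    the argument; these conditions are among those of [kregular]. *)
Lemma mkernel_embed tau M : (0 < tau)%R -> exists (u : C) (v : R),
  forall s, kregular G (kembed tau M) s -> mkernel M s
    = Cexp (u + v * s) * kkernel G (kembed tau M) s.
Proof.
intros Ht.
set (e := fun z => Cexp (embed_exponent tau z)).
assert (E1 : forall c, exp_affine (fun s => e (c - s))).
{ intros c. exists (embed_exponent tau c), (- ln tau)%R. intros s. unfold e. f_equal.
  unfold Cminus at 1. rewrite embed_exponent_plus, RtoC_opp. ring. }
assert (E2 : forall c, exp_affine (fun s => e (1 - c + s))).
{ intros c. exists (embed_exponent tau (1 - c)), (ln tau). intros s. unfold e. f_equal.
  now rewrite embed_exponent_plus. }
destruct (exp_affine_mult _ _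
  (exp_affine_mult _ _ (exp_affine_prod _ (mbnum M) E1) (exp_affine_prod _ (manum M) E2))
  (exp_affine_inv _ (exp_affine_mult _ _ (exp_affine_prod _ (mbden M) E2)
    (exp_affine_prod _ (maden M) E1))))
  as (U & V & HUV).
exists U, V. intros s Hs. rewrite <- HUV. clear HUV U V.
unfold kregular, num_args, den_args, kembed in Hs.
cbn [ktau kalpha bnum anum bden aden] in Hs.
rewrite !map_app, !map_map, !Forall_app in Hs. rewrite !Forall_map in Hs.
rewrite !Forall_forall in Hs.
destruct Hs as (((_ & N2) & _ & N4) & (D1 & _) & D3 & _).
rewrite kkernel_blocks. unfold kembed, mkernel. cbn [ktau kalpha bnum anum bden aden].
rewrite !map_app, !map_map, !Cprod_app.
replace (PI * 0 * s ^ 2 / tau) with (RtoC 0) by (unfold Cdiv; ring). rewrite Cexp_0.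
assert (Eg : forall z, G tau z <> 0 -> Gamma z = e z * G tau (z + tau) * / G tau z).
{ intros z Hz. rewrite (Gamma_embed G HG tau z Ht Hz). unfold e, Cdiv. ring. }
rewrite (map_ext_in (fun b => Gamma (b - s)) (fun b =>
  e (b - s) * G tau (b + tau - s) * / G tau (b - s)) (mbnum M)).
2:{ intros b Hb. rewrite Eg by auto. do 3 f_equal. ring. }
rewrite (map_ext_in (fun a => Gamma (1 - a + s)) (fun a =>
  e (1 - a + s) * G tau (1 + tau - a + s) * / G tau (1 + tau - (a + tau) + s)) (manum M)).
2:{ intros a Ha. specialize (D1 a Ha).
  replace (1 + tau - (a + tau) + s) with (1 - a + s) in * by ring.
    rewrite Eg by auto. do 3 f_equal. ring. }
rewrite (map_ext_in (fun b => Gamma (1 - b + s)) (fun a =>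
  e (1 - a + s) * G tau (1 + tau - a + s) * / G tau (1 + tau - (a + tau) + s)) (mbden M)).
2:{ intros a Ha. specialize (N4 a Ha).
  replace (1 + tau - (a + tau) + s) with (1 - a + s) in * by ring.
    rewrite Eg by auto. do 3 f_equal. ring. }
rewrite (map_ext_in (fun b => Gamma (b - s)) (fun b =>
  e (b - s) * G tau (b + tau - s) * / G tau (b - s)) (maden M)).
2:{ intros b Hb. rewrite Eg by auto. do 3 f_equal. ring. }
rewrite !Cprod_map_mult, !Cprod_map_inv. unfold Cdiv.
rewrite !Cinv_mult_total.
rewrite ?Cprod_map_inv.
rewrite ?Cinv_mult_total, ?Cinv_inv_total. ring.
Qed.

End Representation.

(** * Contour integrals *)

Lemma is_RInt_Cmult (f : R -> C) (a b : R) (c l : C) :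
  @is_RInt C_R_NormedModule f a b l ->
    @is_RInt C_R_NormedModule (fun t => c * f t) a b (c * l).
Proof.
intros H. destruct c as [c1 c2].
assert (H1 := is_RInt_fct_extend_fst (U := R_NormedModule) (V := R_NormedModule) f a b l H).
assert (H2 := is_RInt_fct_extend_snd (U := R_NormedModule) (V := R_NormedModule) f a b l H).
apply (is_RInt_fct_extend_pair (U := R_NormedModule) (V := R_NormedModule) (fun t =>
  (c1, c2) * f t) a b
  (c1 * fst l - c2 * snd l)%R (c1 * snd l + c2 * fst l)%R).
- apply (is_RInt_minus (V := R_NormedModule) (fun t => c1 * fst (f t))%R (fun t =>
    c2 * snd (f t))%R);
  now apply (is_RInt_scal (V := R_NormedModule)).
- apply (is_RInt_plus (V := R_NormedModule) (fun t => c1 * snd (f t))%R (fun t =>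
    c2 * fst (f t))%R);
  now apply (is_RInt_scal (V := R_NormedModule)).
Qed.

(** The substitution [t |-> - t], together with a constant factor. *)
Lemma is_RInt_gen_reflect_scal (f : R -> C) (c l : C) :
  @is_RInt_gen C_R_NormedModule f (Rbar_locally m_infty) (Rbar_locally p_infty) l ->
  @is_RInt_gen C_R_NormedModule (fun t => c * f (- t)%R) (Rbar_locally m_infty)
    (Rbar_locally p_infty) (c * l).
Proof.
intros H P HP.
assert (HP' : locally l (fun y : C => P (c * y))).
{ apply (filterlim_C_mult (locally l) (fun _ => c) (fun y => y) c l); auto.
  apply filterlim_C_const, locally_filter. apply filterlim_id. }
destruct (H _ HP') as [Q S [M1 HQ] [M2 HS] HQS].
exists (fun x => S (- x)%R) (fun x => Q (- x)%R).
- exists (- M2)%R. intros x Hx. apply HS. lra.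
- exists (- M1)%R. intros x Hx. apply HQ. lra.
- intros x y Hx Hy. destruct (HQS (- y)%R (- x)%R Hy Hx) as (v & Hv & HPv).
  cbn [fst snd] in *.
  exists (c * v). split; auto. apply is_RInt_Cmult.
  assert (K := is_RInt_opp _ _ _ _ (is_RInt_comp_opp _ _ _ _ (is_RInt_swap _ _ _ _ Hv))).
  rewrite opp_opp in K. eapply is_RInt_ext; [|exact K].
  intros t _. cbv beta. apply opp_opp.
Qed.

(** * Third differences and the invariance of the stratum *)

(** The third multiplicative difference of [f] with steps [h1], [h2], [h3]. *)
Definition third_diff (h1 h2 h3 : C) (f : C -> C) (s : C) : C :=
  (f (s + h1 + h2 + h3) * f (s + h1) * f (s + h2) * f (s + h3))
  / (f (s + h1 + h2) * f (s + h1 + h3) * f (s + h2 + h3) * f s).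

Lemma third_diff_swap h1 h2 h3 f s : third_diff h1 h2 h3 f s = third_diff h1 h3 h2 f s.
Proof.
unfold third_diff.
replace (s + h1 + h3 + h2) with (s + h1 + h2 + h3) by ring.
replace (s + h3 + h2) with (s + h2 + h3) by ring.
unfold Cdiv. rewrite !Cinv_mult_total. ring.
Qed.

Lemma third_diff_mult h1 h2 h3 f g s :
  third_diff h1 h2 h3 (fun s => f s * g s) s = third_diff h1 h2 h3 f s
    * third_diff h1 h2 h3 g s.
Proof. unfold third_diff, Cdiv. rewrite !Cinv_mult_total. ring. Qed.

Lemma third_diff_inv h1 h2 h3 f s :
  third_diff h1 h2 h3 (fun s => / f s) s = / third_diff h1 h2 h3 f s.
Proof. unfold third_diff, Cdiv. rewrite !Cinv_mult_total, !Cinv_inv_total. ring. Qed.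

Lemma third_diff_prod {A} h1 h2 h3 (f : A -> C -> C) l s :
  third_diff h1 h2 h3 (fun s => Cprod (map (fun a => f a s) l)) s
  = Cprod (map (fun a => third_diff h1 h2 h3 (f a) s) l).
Proof.
induction l as [|a l IH].
- unfold third_diff; simpl. field.
- cbn [map]. rewrite Cprod_cons, <- IH, <- third_diff_mult. reflexivity.
Qed.

Lemma third_diff_ext h1 h2 h3 f g s : (forall t, f t = g t) ->
  third_diff h1 h2 h3 f s = third_diff h1 h2 h3 g s.
Proof. intros H. unfold third_diff. now rewrite !H. Qed.

(** A quadratic polynomial has vanishing third differences. *)
Lemma third_diff_exp_quad h1 h2 h3 (U V W : C) s :
  third_diff h1 h2 h3 (fun s => Cexp (U + V * s + W * s ^ 2)) s = 1.
Proof.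
unfold third_diff, Cdiv. rewrite <- !Cexp_plus, <- Cexp_opp, <- Cexp_plus.
transitivity (Cexp 0); [|apply Cexp_0]. f_equal. ring.
Qed.

Lemma third_diff_mero_eq h1 h2 h3 f g : mero_eq f g ->
  mero_eq (third_diff h1 h2 h3 f) (third_diff h1 h2 h3 g).
Proof.
intros H. assert (H' : forall h, generically (fun s => f (s + h) = g (s + h))).
{ intros h. apply (generically_plus (fun s => f s = g s) h H). }
assert (H0 := H' 0). assert (A1 := H' h1). assert (A2 := H' h2). assert (A3 := H' h3).
assert (A4 := H' (h1 + h2)). assert (A5 := H' (h1 + h3)). assert (A6 := H' (h2 + h3)).
assert (A7 := H' (h1 + h2 + h3)).
generalize (generically_and _ _ H0
  (generically_and _ _ A1 (generically_and _ _ A2 (generically_and _ _ A3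
 (generically_and _ _ A4 (generically_and _ _ A5 (generically_and _ _ A6 A7))))))).
apply generically_imp. intros s (B0 & B1 & B2 & B3 & B4 & B5 & B6 & B7).
rewrite Cplus_0_r in B0. rewrite !Cplus_assoc in *. unfold third_diff. congruence.
Qed.

(** [f x = 1 + e / x + o(1 / x)] as [x] tends to [+oo] along the reals. *)
Definition expands (f : R -> C) (e : C) : Prop :=
  filterlim f (Rbar_locally p_infty) (locally (RtoC 1)) /\
  filterlim (fun x : R => x * (f x - 1)) (Rbar_locally p_infty) (locally e).

Lemma expands_1 : expands (fun _ => 1) 0.
Proof.
split. apply filterlim_const.
apply filterlim_ext with (fun _ => RtoC 0). intros; ring. apply filterlim_const.
Qed.

Lemma expands_mult f g e1 e2 : expands f e1 -> expands g e2 ->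
  expands (fun x => f x * g x) (e1 + e2).
Proof.
intros [F1 F2] [G1 G2].
assert (FF : Filter (Rbar_locally p_infty)) by apply Rbar_locally_filter.
split.
- replace (RtoC 1) with (RtoC 1 * RtoC 1) by ring. now apply filterlim_C_mult.
- apply filterlim_ext with (fun x : R => x * (f x - 1) * g x + x * (g x - 1)). intros; ring.
  replace (e1 + e2) with (e1 * 1 + e2) by ring.
  apply filterlim_C_plus; auto. now apply filterlim_C_mult.
Qed.

Lemma expands_factor h d : expands (fun x => 1 + h / (x + d)) h.
Proof.
assert (FF : Filter (Rbar_locally p_infty)) by apply Rbar_locally_filter.
assert (Hi : filterlim (fun x : R => RtoC (/ x)%R) (Rbar_locally p_infty)
  (locally (RtoC 0))).
{ apply filterlim_C_components; auto. split; simpl.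
  - apply (is_lim_inv (fun x => x) p_infty p_infty). apply is_lim_id. discriminate.
  - apply filterlim_const. }
assert (Hd : filterlim (fun x : R => / (1 + d * RtoC (/ x)%R)) (Rbar_locally p_infty)
  (locally (RtoC 1))).
{ replace (locally (RtoC 1)) with (locally (/ (1 + d * 0))).
  2:{ f_equal. rewrite Cmult_0_r, Cplus_0_r. apply Cinv_1. }
  apply filterlim_C_inv; auto. rewrite Cmult_0_r, Cplus_0_r. apply C1_nz.
  apply filterlim_C_plus; auto. apply filterlim_C_const; auto.
  apply filterlim_C_mult; auto. apply filterlim_C_const; auto. }
assert (Hx : forall x : R, (0 < x)%R -> / (x + d)
  = RtoC (/ x)%R * / (1 + d * RtoC (/ x)%R)).
{ intros x Hx. rewrite RtoC_inv by lra. rewrite <- Cinv_mult_total. f_equal.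
  field. apply RtoC_neq; lra. }
split.
- apply filterlim_ext_loc with (fun x : R => 1 + h
    * (RtoC (/ x)%R * / (1 + d * RtoC (/ x)%R))).
  { exists 0%R. intros x H0. unfold Cdiv. now rewrite Hx. }
  replace (locally (RtoC 1)) with (locally (1 + h * (0 * 1))) by (f_equal; ring).
  apply filterlim_C_plus; auto. apply filterlim_C_const; auto.
  apply filterlim_C_mult; auto. apply filterlim_C_const; auto.
  apply filterlim_C_mult; auto.
- apply filterlim_ext_loc with (fun x : R => h * (/ (1 + d * RtoC (/ x)%R))).
  { exists 0%R. intros x H0. unfold Cdiv. rewrite Hx by auto. rewrite RtoC_inv at 2 by lra.
    transitivity (h * / (1 + d * RtoC (/ x)%R) * (x * / x)).
    - rewrite Cinv_r by (apply RtoC_neq; lra). ring.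
    - ring. }
  replace (locally h) with (locally (h * 1)) by (f_equal; ring).
  apply filterlim_C_mult; auto. apply filterlim_C_const; auto.
Qed.

Lemma expands_prod {A} (h : C) (d : A -> C) l :
  expands (fun x => Cprod (map (fun a => 1 + h / (x + d a)) l)) (INR (length l) * h).
Proof.
induction l as [|a l IH].
- simpl. rewrite Cmult_0_l. apply expands_1.
- cbn [length map]. rewrite S_INR, RtoC_plus.
  replace ((INR (length l) + 1) * h) with (h + INR (length l) * h) by ring.
  apply (expands_mult (fun x => 1 + h / (x + d a))); auto. apply expands_factor.
Qed.

(** Exceptional points may accumulate at infinity along the real axis, but they
    cannot exhaust a half-line. *)
Lemma locally_finite_avoid (E : C -> Prop) (M : R) : locally_finite E -> exists x : R,
  (M < x)%R /\ ~ E x.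
Proof.
intros HE. destruct (HE (Rabs M + 1)%R) as [l Hl].
apply Classical_Prop.NNPP. intros HN.
assert (Hall : forall x : R, (M < x)%R -> E x).
{ intros x Hx. apply Classical_Prop.NNPP. intros H. apply HN. now exists x. }
(* One point more than the bounded part of [E] has: a pigeonhole argument. *)
set (f := fun j : nat => RtoC (M + / INR (S j))%R).
assert (Hpos : forall j, (0 < INR (S j))%R) by (intros; apply lt_0_INR; lia).
assert (Hinc : incl (map f (seq 0 (S (length l)))) l).
{ intros z Hz. apply in_map_iff in Hz. destruct Hz as (j & <- & _).
  assert (0 < / INR (S j) <= 1)%R.
  { split. now apply Rinv_0_lt_compat. rewrite <- Rinv_1. apply Rinv_le_contravar. lra.
    rewrite S_INR. generalize (pos_INR j). lra. }
  apply Hl.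
  - apply Hall. lra.
  - unfold f. rewrite Cmod_R. eapply Rle_trans; [apply Rabs_triang|].
    rewrite (Rabs_pos_eq (/ _)) by lra. lra. }
apply NoDup_incl_length in Hinc.
- rewrite length_map, length_seq in Hinc. lia.
- apply FinFun.Injective_map_NoDup; [|apply seq_NoDup].
  intros i j Hij. unfold f in Hij. apply RtoC_inj in Hij.
  assert (E1 : (/ INR (S i) = / INR (S j))%R) by lra.
  apply (f_equal Rinv) in E1. rewrite !Rinv_inv in E1. apply INR_eq in E1. lia.
Qed.

(** The limit is taken along the reals outside the exceptional set. *)
Lemma expands_generically_unique (f g : C -> C) e1 e2 :
  mero_eq f g -> expands (fun x => f x) e1 -> expands (fun x => g x) e2 -> e1 = e2.
Proof.
intros (E & HE & H) [_ H1] [_ H2].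
set (F := within (fun x : R => ~ E x) (Rbar_locally p_infty)).
assert (FF : ProperFilter F).
{ constructor.
  - intros P [M HM]. destruct (locally_finite_avoid E M HE) as (x & Hx & HEx). exists x.
    now apply HM.
  - apply within_filter, Rbar_locally_filter. }
assert (Hle : filter_le F (Rbar_locally p_infty)).
{ intros P HP. unfold F, within. revert HP. apply filter_imp. auto. }
apply (filterlim_C_unique F (fun x : R => x * (f x - 1))).
- now apply (filterlim_filter_le_1 (F := Rbar_locally p_infty)).
- apply filterlim_ext_loc with (fun x : R => x * (g x - 1)).
  + exists 0%R. intros x _ Hx. now rewrite H.
  + now apply (filterlim_filter_le_1 (F := Rbar_locally p_infty)).
Qed.

Section Invariance.
Context (G : R -> C -> C) (HG : forall tau : R, (0 < tau)%R -> is_double_gamma tau (G tau)).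

(** The four values of [G] that occur as divisors in [third_diff_G] do not vanish. *)
Definition G_shifts_regular (tau : R) (h x : C) : Prop :=
  G tau x <> 0 /\ G tau (x + tau) <> 0 /\ G tau (x + h) <> 0 /\ G tau (x + tau + h) <> 0.

Lemma generically_G_shifts_regular tau (h : C) : (0 < tau)%R ->
  generically (G_shifts_regular tau h).
Proof.
intros Ht. assert (H := generically_G_neq_0 G HG tau Ht).
repeat apply generically_and; auto.
- apply (generically_plus (fun x => G tau x <> 0) tau H).
- apply (generically_plus (fun x => G tau x <> 0) h H).
- apply generically_imp with (2 := generically_plus (fun x => G tau x <> 0) (tau + h) H).
  intros s. now rewrite Cplus_assoc.
Qed.

Lemma G_neq_0_arg_neq_0 tau x : (0 < tau)%R -> G tau x <> 0 -> x <> 0.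
Proof.
intros Ht H ->. apply H. apply double_gamma_zeros; auto. exists O, O. simpl.
rewrite Rmult_0_l, Rplus_0_l. ring.
Qed.

(** The step [1] turns [G] into [Gamma (x / tau)], the step [tau] turns this into
    [x / tau], and the step [h] leaves the ratio below. *)
Lemma third_diff_G tau h x : (0 < tau)%R -> G_shifts_regular tau h x ->
  third_diff 1 tau h (G tau) x = (x + h) / x.
Proof.
intros Ht (R0 & R1 & R2 & R3). unfold third_diff.
assert (Hc : RtoC tau <> 0) by (apply RtoC_neq; lra).
assert (X0 := G_neq_0_arg_neq_0 _ _ Ht R0). assert (X2 := G_neq_0_arg_neq_0 _ _ Ht R2).
replace (x + 1 + tau + h) with (x + tau + h + 1) by ring.
replace (x + 1 + tau) with (x + tau + 1) by ring.
replace (x + 1 + h) with (x + h + 1) by ring.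
rewrite !(G_shift_1 G HG) by auto.
replace ((x + tau + h) / tau) with ((x + h) / tau + 1) by (field; auto).
replace ((x + tau) / tau) with (x / tau + 1) by (field; auto).
rewrite !Gamma_shift by (apply Cdiv_neq_0; auto).
assert (Gamma (x / tau) <> 0).
{ apply Gamma_neq_0. intros Hn. apply R0, double_gamma_zeros; auto.
  now apply nonpos_int_div_lattice. }
assert (Gamma ((x + h) / tau) <> 0).
{ apply Gamma_neq_0. intros Hn. apply R2, double_gamma_zeros; auto.
  now apply nonpos_int_div_lattice. }
field. repeat split; auto.
Qed.

Lemma third_diff_G_plus tau h c : (0 < tau)%R ->
  generically (fun s => third_diff 1 tau h (fun s => G tau (c + s)) s = 1 + h / (s + c)).
Proof.
intros Ht. apply generically_imp
  with (2 := generically_plus _ c (generically_G_shifts_regular tau h Ht)).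
intros s Hs. assert (E := third_diff_G tau h _ Ht Hs).
assert (X0 := G_neq_0_arg_neq_0 _ _ Ht (proj1 Hs)).
replace (1 + h / (s + c)) with ((s + c + h) / (s + c)) by (field; auto).
rewrite <- E. unfold third_diff.
replace (c + (s + 1 + tau + h)) with (s + c + 1 + tau + h) by ring.
replace (c + (s + 1 + tau)) with (s + c + 1 + tau) by ring.
replace (c + (s + 1 + h)) with (s + c + 1 + h) by ring.
replace (c + (s + tau + h)) with (s + c + tau + h) by ring.
replace (c + (s + 1)) with (s + c + 1) by ring.
replace (c + (s + tau)) with (s + c + tau) by ring.
replace (c + (s + h)) with (s + c + h) by ring.
now rewrite (Cplus_comm c s).
Qed.

(** Reflecting the argument inverts the third difference; the parameter [b] enters
    through [1 + tau - b], as it does in [third_diff_G_plus] for an argument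
    [1 + tau - b + s]. *)
Lemma third_diff_G_minus tau h b : (0 < tau)%R ->
  generically (fun s => third_diff 1 tau h (fun s => G tau (b - s)) s
    = 1 + h / (s + (1 + tau - b))).
Proof.
intros Ht. apply generically_imp
  with (2 := generically_minus _ (b - 1 - tau - h) (generically_G_shifts_regular tau h Ht)).
intros s Hs. assert (E := third_diff_G tau h _ Ht Hs).
assert (X0 := G_neq_0_arg_neq_0 _ _ Ht (proj1 Hs)).
assert (X2 := G_neq_0_arg_neq_0 _ _ Ht (proj1 (proj2 (proj2 Hs)))).
set (y := b - 1 - tau - h - s) in *.
replace (s + (1 + tau - b)) with (- (y + h)) by (unfold y; ring).
assert (X3 : - (y + h) <> 0).
{ intros E0. apply X2. replace (y + h) with (- - (y + h)) by ring. rewrite E0. ring. }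
replace (1 + h / - (y + h)) with (/ ((y + h) / y)) by (field; auto).
rewrite <- E. unfold third_diff, Cdiv. rewrite !Cinv_mult_total, !Cinv_inv_total.
replace (b - (s + 1 + tau + h)) with y by (unfold y; ring).
replace (b - (s + 1)) with (y + tau + h) by (unfold y; ring).
replace (b - (s + tau)) with (y + 1 + h) by (unfold y; ring).
replace (b - (s + h)) with (y + 1 + tau) by (unfold y; ring).
replace (b - (s + 1 + tau)) with (y + h) by (unfold y; ring).
replace (b - (s + 1 + h)) with (y + tau) by (unfold y; ring).
replace (b - (s + tau + h)) with (y + 1) by (unfold y; ring).
replace (b - s) with (y + 1 + tau + h) by (unfold y; ring).
ring.
Qed.

Lemma Cprod_Forall_eq {A} (f g : A -> C) l : List.Forall (fun a => f a = g a) l ->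
  Cprod (map f l) = Cprod (map g l).
Proof. intros H. f_equal. apply map_ext_in. now apply Forall_forall. Qed.

(** The constants [d] of the factors [1 + h / (s + d)] contributed by the numerator
    blocks; [den_shifts] is the analogue for the denominator blocks. *)
Definition num_shifts (D : Kdata) : list C :=
  map (fun x => 1 + ktau D - x) (bnum D ++ anum D).
Definition den_shifts (D : Kdata) : list C :=
  map (fun x => 1 + ktau D - x) (bden D ++ aden D).

(** The exponential factors drop out; the factors of the denominator blocks are kept
    on the left-hand side. *)
Lemma third_diff_represents D phi (h : C) : (0 < ktau D)%R -> represents G D phi ->
  generically (fun s => third_diff 1 (ktau D) h phi s *
      Cprod (map (fun d => 1 + h / (s + d)) (den_shifts D))
    = Cprod (map (fun d => 1 + h / (s + d)) (num_shifts D))).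
Proof.
intros Ht (u & v & H). set (tau := ktau D) in *.
assert (H' := third_diff_mero_eq 1 tau h _ _ H).
assert (P := third_diff_G_plus tau h). assert (Mi := third_diff_G_minus tau h).
assert (B1 := generically_Forall (fun b s => third_diff 1 tau h (fun s => G tau (b - s)) s
  = 1 + h / (s + (1 + tau - b))) (bnum D) (fun b _ => Mi b Ht)).
assert (B2 := generically_Forall (fun a s =>
  third_diff 1 tau h (fun s => G tau (1 + tau - a + s)) s = 1 + h / (s + (1 + tau - a)))
  (anum D) (fun a _ => P _ Ht)).
assert (B3 := generically_Forall (fun a s =>
  third_diff 1 tau h (fun s => G tau (1 + tau - a + s)) s = 1 + h / (s + (1 + tau - a)))
  (bden D) (fun a _ => P _ Ht)).
assert (B4 := generically_Forall (fun b s => third_diff 1 tau h (fun s => G tau (b - s)) s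
  = 1 + h / (s + (1 + tau - b))) (aden D) (fun b _ => Mi b Ht)).
assert (N1 : generically (fun s =>
  List.Forall (fun d => 1 + h / (s + d) <> 0) (den_shifts D))).
{ apply generically_Forall. intros d _.
  assert (N : forall c : C, generically (fun s => s + c <> 0)).
  { intros c. apply (generically_plus (fun s => s <> 0) c).
    apply generically_imp with (2 := generically_G_neq_0 G HG tau Ht). intros s.
    now apply G_neq_0_arg_neq_0. }
  apply generically_imp with (2 := generically_and _ _ (N d) (N (d + h))).
  intros s [N1 N2] E. apply N2.
  replace (s + (d + h)) with ((1 + h / (s + d)) * (s + d)) by (field; auto).
  rewrite E. ring. }
generalize (generically_and _ _ H'
  (generically_and _ _ B1 (generically_and _ _ B2
  (generically_and _ _ B3 (generically_and _ _ B4 N1))))).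
apply generically_imp. intros s (E & E1 & E2 & E3 & E4 & N).
rewrite E, third_diff_mult. clear E.
rewrite (third_diff_ext _ _ _ (fun s => Cexp (u - v * s)) (fun s =>
  Cexp (u + (- v) * s + 0 * s ^ 2))).
2:{ intros t. f_equal. ring. }
rewrite third_diff_exp_quad.
rewrite (third_diff_ext _ _ _ (kkernel G D) (fun s =>
  Cprod (map (fun b => G tau (b - s)) (bnum D))
  * Cprod (map (fun a => G tau (1 + tau - a + s)) (anum D))
  * / (Cprod (map (fun b => G tau (1 + tau - b + s)) (bden D))
     * Cprod (map (fun a => G tau (a - s)) (aden D)))
  * Cexp (0 + 0 * s + PI * kalpha D / tau * s ^ 2))).
2:{ intros t. rewrite kkernel_blocks. fold tau. unfold Cdiv. do 2 f_equal. ring. }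
rewrite !third_diff_mult, third_diff_inv, !third_diff_mult, third_diff_exp_quad,
  !third_diff_prod.
rewrite (Cprod_Forall_eq _ _ _ E1), (Cprod_Forall_eq _ _ _ E2), (Cprod_Forall_eq _ _ _ E3),
  (Cprod_Forall_eq _ _ _ E4).
assert (ND : Cprod (map (fun d => 1 + h / (s + d)) (den_shifts D)) <> 0).
{ apply Cprod_neq_0. now apply Forall_forall. }
unfold num_shifts, den_shifts in *. fold tau in ND. fold tau.
rewrite !map_map, !map_app, !Cprod_app in *.
match goal with |- RtoC 1 * (?a * / ?b * RtoC 1) * ?b' = ?a' =>
  transitivity (a * (/ b * b)); [ring|] end.
rewrite Cinv_l by exact ND. ring.
Qed.

(** [N / tau] depends only on the represented function.  The third differences with
    steps [1, tau1, tau2] and [1, tau2, tau1] agree; the comparison is made after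
    multiplying out the denominators. *)
Lemma stratum_ratio D1 D2 phi : (0 < ktau D1)%R -> (0 < ktau D2)%R ->
  represents G D1 phi -> represents G D2 phi ->
  (IZR (stratum D1) * ktau D2 = IZR (stratum D2) * ktau D1)%R.
Proof.
intros Ht1 Ht2 H1 H2.
assert (A1 := third_diff_represents D1 phi (ktau D2) Ht1 H1).
assert (A2 := third_diff_represents D2 phi (ktau D1) Ht2 H2).
set (t1 := ktau D1) in *. set (t2 := ktau D2) in *.
assert (E := expands_generically_unique
 (fun s => Cprod (map (fun d => 1 + t2 / (s + d)) (num_shifts D1))
   * Cprod (map (fun d => 1 + t1 / (s + d)) (den_shifts D2)))
 (fun s => Cprod (map (fun d => 1 + t1 / (s + d)) (num_shifts D2))
   * Cprod (map (fun d => 1 + t2 / (s + d)) (den_shifts D1)))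
 _ _
 ltac:(generalize (generically_and _ _ A1 A2); apply generically_imp; intros s [E1 E2];
   rewrite <- E1, <- E2, (third_diff_swap 1 t2 t1); ring)
 (expands_mult _ _ _ _ (expands_prod t2 (fun d => d) _) (expands_prod t1 (fun d => d) _))
 (expands_mult _ _ _ _ (expands_prod t1 (fun d => d) _) (expands_prod t2 (fun d => d) _))).
unfold num_shifts, den_shifts in E. rewrite !length_map, !length_app, !plus_INR in E.
rewrite !stratum_blocks, !minus_IZR, !plus_IZR, <- !INR_IZR_INZ.
rewrite <- !RtoC_mult, <- !RtoC_plus in E. apply RtoC_inj in E. lra.
Qed.

(** * Closure of the stratum and its consequences *)

Lemma kregular_generically D : (0 < ktau D)%R -> generically (kregular G D).
Proof.
intros Ht. assert (H := generically_G_neq_0 G HG _ Ht).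
assert (B1 := generically_Forall (fun b s => G (ktau D) (b - s) <> 0) (bnum D) (fun b _ =>
  generically_minus _ b H)).
assert (B4 := generically_Forall (fun b s => G (ktau D) (b - s) <> 0) (aden D) (fun b _ =>
  generically_minus _ b H)).
assert (P : forall a : C, generically (fun s => G (ktau D) (1 + ktau D - a + s) <> 0)).
{ intros a. apply generically_imp with (2 := generically_plus _ (1 + ktau D - a) H).
  intros s. now rewrite Cplus_comm. }
assert (B2 := generically_Forall (fun a s => G (ktau D) (1 + ktau D - a + s) <> 0) (anum D)
  (fun a _ => P a)).
assert (B3 := generically_Forall (fun a s => G (ktau D) (1 + ktau D - a + s) <> 0) (bden D)
  (fun a _ => P a)).
generalize (generically_and _ _ B1 (generically_and _ _ B2 (generically_and _ _ B3 B4))).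
apply generically_imp. intros s (E1 & E2 & E3 & E4).
unfold kregular, num_args, den_args. rewrite !Forall_app, !Forall_map. auto.
Qed.

Lemma represents_meijer tau M : (0 < tau)%R ->
  represents G (kinvert (kembed tau M)) (fun s => mkernel M (- s)).
Proof.
intros Ht. apply represents_invert. destruct (mkernel_embed G HG tau M Ht) as (u & v & H).
exists u, (- RtoC v). apply generically_imp with (2 :=
  kregular_generically (kembed tau M) Ht).
intros s Hs. rewrite H by auto. do 2 f_equal. ring.
Qed.

Lemma produced_represented tau phi : produced tau phi ->
  (0 < tau)%R /\ exists D : Kdata, ktau D = tau /\ stratum D = 0%Z /\ represents G D phi.
Proof.
induction 1 as [tau M Ht|tau o phi Ho _ [Ht (D & E & HN & HD)]|tau phi psi _
  [Ht (D1 & E1 & N1 & H1)] _ [_ (D2 & E2 & N2 & H2)]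
  |tau u v phi _ [Ht (D & E & HN & HD)]|tau phi psi Heq _ [Ht (D & E & HN & HD)]].
- split; auto. exists (kinvert (kembed tau M)). split; [reflexivity|]. split.
  + now rewrite stratum_invert, stratum_embed.
  + now apply represents_meijer.
- split. { destruct o; auto. now apply Rinv_0_lt_compat. }
  subst tau. exists (op_data o D). split; [apply ktau_op|]. split.
  + now rewrite stratum_op.
  + now apply represents_op.
- split; auto. subst tau. exists (kconvolve D1 D2). split; auto. split.
  + rewrite stratum_convolve, N1, N2. reflexivity.
  + apply represents_convolve; auto.
- split; auto. exists D. split; auto. split; auto. now apply represents_scale.
- split; auto. exists D. split; auto. split; auto. now apply represents_mero_eq with phi.
Qed.

Lemma not_produced D tau phi : (0 < ktau D)%R -> stratum D <> 0%Z -> produced tau phi ->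
  ~ represents G D phi.
Proof.
intros Ht HN HP HD. destruct (produced_represented _ _ HP) as (Ht' & D' & E & HN' & HD').
assert (K := stratum_ratio D D' phi Ht ltac:(lra) HD HD'). rewrite HN', Rmult_0_l in K.
apply HN, eq_IZR. apply Rmult_integral in K. destruct K; auto. lra.
Qed.

(** Along a regular contour the two integrands agree up to the constant [Cexp u]; the
    substitution [s |-> - s] turns [z^s] into [z^(-s)]. *)
Lemma K_value_of_M_value tau M u (v : R) g zeta w : (0 < tau)%R ->
  (forall s, kregular G (kembed tau M) s -> mkernel M s
    = Cexp (u + v * s) * kkernel G (kembed tau M) s) ->
  (forall t : R, kregular G (kembed tau M) (path g t)) ->
  is_M_value M g zeta w ->
  is_K_value G (kinvert (kembed tau M)) (creflect g) (zeta + v) (w / Cexp u).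
Proof.
intros Ht H Hr HM. unfold is_K_value, is_M_value, is_contour_int in *.
assert (K := is_RInt_gen_reflect_scal _ (/ Cexp u) _ HM).
replace (2 * PI * Ci * (w / Cexp u)) with (/ Cexp u * (2 * PI * Ci * w))
  by (unfold Cdiv; ring).
revert K. apply is_RInt_gen_ext.
exists (fun _ => True) (fun _ => True); [now exists 0%R|now exists 0%R|].
intros x y _ _ t _. unfold creflect. cbn [path speed]. cbv beta.
rewrite H by auto. rewrite kkernel_invert. set (s := path g (- t)%R).
replace (- - s) with s by ring. rewrite Cexp_plus.
replace (s * (zeta + v)) with (s * zeta + v * s) by ring. rewrite Cexp_plus.
assert (Hu := Cexp_neq_0 u). match goal with |- ?a = ?b => change (@eq C a b) end. field.
auto.
Qed.

Lemma ratio_shift tau cs ds : (0 < tau)%R ->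
  mero_eq (fun s => kkernel G (ratio_data tau cs ds) (s + 1))
          (fun s => gamma_ratio tau cs ds s * kkernel G (ratio_data tau cs ds) s).
Proof.
intros Ht. assert (H := generically_G_neq_0 G HG _ Ht).
assert (P : forall c : C, generically (fun s =>
  G tau (c + s + 1) = Gamma ((c + s) / tau) * G tau (c + s))).
{ intros c. apply generically_imp with (2 := generically_plus _ c H). intros s Hs.
  rewrite (Cplus_comm c s). now apply G_shift_1. }
assert (B1 := generically_Forall (fun c s => G tau (c + s + 1)
  = Gamma ((c + s) / tau) * G tau (c + s)) cs (fun c _ => P c)).
assert (B2 := generically_Forall (fun c s => G tau (c + s + 1)
  = Gamma ((c + s) / tau) * G tau (c + s)) ds (fun c _ => P c)).
generalize (generically_and _ _ B1 B2). apply generically_imp. intros s (E1 & E2).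
rewrite !kkernel_blocks. unfold ratio_data, gamma_ratio.
cbn [ktau kalpha bnum anum bden aden map].
rewrite !map_map, !Cprod_nil.
assert (HE : forall z : C, PI * 0 * z ^ 2 / tau = 0) by (intros; unfold Cdiv; ring).
rewrite !HE, Cexp_0.
assert (HA : forall l, Cprod (map (fun c => G tau (1 + tau - (1 + tau - c) + (s + 1))) l)
  = Cprod (map (fun c => G tau (c + s + 1)) l)).
{ intros l. apply Cprod_map_ext. intros c. f_equal. ring. }
assert (HB : forall l, Cprod (map (fun c => G tau (1 + tau - (1 + tau - c) + s)) l)
  = Cprod (map (fun c => G tau (c + s)) l)).
{ intros l. apply Cprod_map_ext. intros c. f_equal. ring. }
rewrite !HA, !HB, (Cprod_Forall_eq _ _ _ E1), (Cprod_Forall_eq _ _ _ E2), !Cprod_map_mult.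
unfold Cdiv. rewrite !Cinv_mult_total, Cinv_1. ring.
Qed.

End Invariance.

Theorem corollary10p9 (G : R -> C -> C)
  (HG : forall tau : R, (0 < tau)%R -> is_double_gamma tau (G tau)) :
  (* the embedding formula for the gamma function *)
  (forall tau : R, (0 < tau)%R ->
     mero_eq Gamma
       (fun s => RtoC (Rpower (2 * PI) ((1 - tau) / 2))
                 * Cexp ((s - 1 / 2) * ln tau) * (G tau (s + tau) / G tau s)))
  (* every Meijer G-function becomes C K(lambda z) with N = 0 *)
  /\ (forall (tau : R) (M : Mdata), (0 < tau)%R ->
        stratum (kembed tau M) = 0%Z
        /\ stratum (kinvert (kembed tau M)) = 0%Z
        /\ exists (u : C) (v : R),
             mero_eq (mkernel M)
               (fun s => Cexp (u + v * s) * kkernel G (kembed tau M) s)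
             /\ forall (g : contour) (zeta w : C),
                  is_contour g ->
                  (forall t : R, kregular G (kembed tau M) (path g t)) ->
                  is_M_value M g zeta w ->
                  is_K_value G (kinvert (kembed tau M)) (creflect g)
                    (zeta + v) (w / Cexp u))
  (* pFq is a Meijer G-function: its series is, up to a constant, the sum of the
     residues of the kernel at s = 0, 1, 2, ..., at argument z or -z *)
  /\ (forall a1 a2 b : list C,
        List.Forall (fun x => ~ nonpos_int x) a1 ->
        List.Forall nonpos_int a2 ->
        List.Forall (fun x => ~ nonpos_int x) b ->
        exists c : C, c <> 0 /\
        forall k : nat,
          filterlim
            (fun s => (s - INR k) * mkernel (pFq_meijer a1 a2 b) s)
            (locally' (RtoC (INR k)))
            (locally (c * ((- (1)) ^ (S (length a2))) ^ k
                      * pFq_coef (a1 ++ a2) b k)))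
  (* single-kernel operations and the three laws preserve N *)
  /\ (forall (o : operation) (D : Kdata), (0 < ktau D)%R -> op_ok o ->
        ktau (op_data o D) = op_tau o (ktau D)
        /\ represents G (op_data o D) (op_kernel o (ktau D) (kkernel G D))
        /\ stratum (op_data o D) = stratum D)
  (* Mellin convolution adds N *)
  /\ (forall D1 D2 : Kdata, (0 < ktau D1)%R -> ktau D1 = ktau D2 ->
        mero_eq (fun s => kkernel G D1 s * kkernel G D2 s)
          (kkernel G (kconvolve D1 D2))
        /\ stratum (kconvolve D1 D2) = (stratum D1 + stratum D2)%Z)
  (* closure of the stratum N = 0 *)
  /\ (forall (tau : R) (phi : C -> C), produced tau phi ->
        exists D : Kdata,
          ktau D = tau /\ stratum D = 0%Z /\ represents G D phi)
  (* (a) *)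
  /\ (forall D : Kdata, has_type D 1 1 2 2 -> stratum D = 0%Z)
  /\ (forall D : Kdata, has_type D 1 2 3 3 -> stratum D = 0%Z)
  /\ (forall (p : nat) (D : Kdata),
        has_type D (p + 1) 1 (p + 2) (p + 2) -> stratum D = 0%Z)
  /\ (forall D : Kdata, has_type D 2 0 2 2 -> stratum D = 0%Z)
  (* (b) *)
  /\ (forall D : Kdata, (0 < ktau D)%R -> stratum D <> 0%Z ->
        forall (tau : R) (phi : C -> C),
          produced tau phi -> ~ represents G D phi)
  (* (b), the instance M(s + 1) = R(s) M(s) *)
  /\ (forall (tau : R) (cs ds : list C), (0 < tau)%R ->
        length cs <> length ds ->
        mero_eq (fun s => kkernel G (ratio_data tau cs ds) (s + 1))
          (fun s => gamma_ratio tau cs ds s * kkernel G (ratio_data tau cs ds) s)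
        /\ stratum (ratio_data tau cs ds)
           = (Z.of_nat (length cs) - Z.of_nat (length ds))%Z
        /\ stratum (ratio_data tau cs ds) <> 0%Z
        /\ forall (tau' : R) (phi : C -> C),
             produced tau' phi -> ~ represents G (ratio_data tau cs ds) phi).
Proof.
split; [intros; now apply Gamma_embed_formula|].
split.
{ intros tau M Ht. split; [apply stratum_embed|]. split; [now rewrite stratum_invert, stratum_embed|].
  destruct (mkernel_embed G HG tau M Ht) as (u & v & H). exists u, v. split.
  - apply generically_imp with (2 := kregular_generically G HG (kembed tau M) Ht). exact H.
  - intros g zeta w _ Hr HM. now apply K_value_of_M_value with (1 := Ht) (2 := H). }
split; [apply pFq_residues|].
split.
{ intros o D Ht Ho. split; [apply ktau_op|]. split; [|apply stratum_op].
  apply represents_op; auto. apply represents_kernel. }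
split.
{ intros D1 D2 Ht E. split; [|apply stratum_convolve].
  apply generically_all. intros s. now rewrite kkernel_convolve. }
split; [intros tau phi H; now apply (produced_represented G HG)|].
split; [intros D (H1 & H2 & H3 & H4); unfold stratum; rewrite H1, H2, H3, H4; reflexivity|].
split; [intros D (H1 & H2 & H3 & H4); unfold stratum; rewrite H1, H2, H3, H4; reflexivity|].
split; [intros p D (H1 & H2 & H3 & H4); unfold stratum; rewrite H1, H2, H3, H4; lia|].
split; [intros D (H1 & H2 & H3 & H4); unfold stratum; rewrite H1, H2, H3, H4; reflexivity|].
split; [intros D Ht HN tau phi; now apply not_produced|].
intros tau cs ds Ht Hl.
assert (E : stratum (ratio_data tau cs ds) = (Z.of_nat (length cs) - Z.of_nat (length ds))%Z).
{ rewrite stratum_blocks. unfold ratio_data. cbn [bnum anum bden aden length]. rewrite !length_map. lia. }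
assert (HN : stratum (ratio_data tau cs ds) <> 0%Z) by lia.
split; [now apply ratio_shift|]. split; [exact E|]. split; [exact HN|].
intros tau' phi. now apply not_produced.
Qed.
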